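(* Let $k\ge3$ and let $1\le n_1\le\cdots\le n_k$ be integers. Then $\sigma_4(\mathbf{P}^{n_1}\times\cdots\times\mathbf{P}^{n_k})$ is non-defective, with exactly the following exceptions (in which it is defective, all with $k=3$): (a) $(n_1,n_2,n_3)=(1,2,a)$ with $a\ge4$; (b) $(n_1,n_2,n_3)=(2,2,2)$.
   Context: Work over a field of characteristic zero (not necessarily algebraically closed). $\mathbf{P}^{n_1}\times\cdots\times\mathbf{P}^{n_k}$ denotes the Segre variety embedded in $\mathbf{P}(V_1\otimes\cdots\otimes V_k)$, where $\dim V_i=n_i+1$. For a variety $X\subseteq\mathbf{P}^m$, the $s$-secant variety $\sigma_s(X)$ is the Zariski closure of the union of the linear spans of $s$-tuples of points of $X$. For the Segre variety $X$, $\sigma_s(X)$ is called non-defective if it has the expected dimension $\min\{\prod_{i=1}^k(n_i+1)-1,\ s\sum_{i=1}^kn_i+s-1\}$, and defective if its dimension is smaller. *)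

(* Defs.v *)
From HB Require Import structures.
From mathcomp Require Import all_boot all_order all_algebra.
From mathcomp Require Import mpoly.

Set Implicit Arguments.
Unset Strict Implicit.
Unset Printing Implicit Defensive.

Import GRing.Theory.
Local Open Scope ring_scope.

Section ProjectiveSets.

Variables (F : fieldType) (m : nat).

(* The F-rational points of P(F^m): the lines through the origin of F^m. *)
Definition ppoint := {L : {vspace 'rV[F]_m} | \dim L == 1%N}.

Definition vanishes_at (f : {mpoly F[m]}) (x : ppoint) : Prop :=
  forall v : 'rV[F]_m, v \in val x -> f.@[fun i => v 0 i] = 0.

Definition vanishes_on (f : {mpoly F[m]}) (Z : ppoint -> Prop) : Prop :=
  forall x : ppoint, Z x -> vanishes_at f x.

Definition zariski_closure (Z : ppoint -> Prop) : ppoint -> Prop :=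
  fun x => forall (d : nat) (f : {mpoly F[m]}),
    f \is d.-homog -> vanishes_on f Z -> vanishes_at f x.

Definition span_points (s : nat) (x : 'I_s -> ppoint) : {vspace 'rV[F]_m} :=
  (\sum_(i < s) val (x i))%VS.

Definition secant_variety (s : nat) (X : ppoint -> Prop) : ppoint -> Prop :=
  zariski_closure (fun y => exists x : 'I_s -> ppoint,
    (forall i, X (x i)) /\ (val y <= span_points x)%VS).

(* The points of Proj (F[x_1, ..., x_m] / I(Z)): homogeneous primes not
   containing the irrelevant ideal, and containing I(Z), i.e. containing every
   homogeneous polynomial vanishing on Z (these generate I(Z)). *)
Definition proj_prime (Z : ppoint -> Prop) (P : {pred {mpoly F[m]}}) : Prop :=
  [/\ idealr_closed P,
      prime_idealr_closed P,
      forall (d : nat) (f : {mpoly F[m]}), f \in P -> pihomog mdeg d f \in P,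
      exists i : 'I_m, 'X_i \notin P
    & forall (d : nat) (f : {mpoly F[m]}),
        f \is d.-homog -> vanishes_on f Z -> f \in P].

Definition has_chain (Z : ppoint -> Prop) (d : nat) : Prop :=
  exists P : 'I_d.+1 -> {pred {mpoly F[m]}},
    (forall i, proj_prime Z (P i)) /\
    (forall i j : 'I_d.+1, (i < j)%N ->
       {subset P i <= P j} /\ exists2 f, f \in P j & f \notin P i).

(* Krull dimension of Proj (F[x_1, ..., x_m] / I(Z)), that is, the dimension of
   Z as a variety over F. Chains of primes are used, rather than chains of
   closed sets of F-rational points, because F need not be algebraically
   closed: an integral closed subscheme may have too few rational points. *)
Definition has_dim (Z : ppoint -> Prop) (d : nat) : Prop :=
  has_chain Z d /\ forall e : nat, has_chain Z e -> (e <= d)%N.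

End ProjectiveSets.

Section Segre.

Variables (F : fieldType) (k : nat) (n : 'I_k -> nat).

(* The index set of the coordinates on V_1 (x) ... (x) V_k, dim V_i = n i + 1. *)
Definition multi_index := {dffun forall i : 'I_k, 'I_(n i).+1}.

Definition pure_tensor (v : forall i : 'I_k, 'rV[F]_(n i).+1) :
    'rV[F]_#|{: multi_index}| :=
  \row_(j < #|{: multi_index}|) \prod_(i < k) v i 0 ((enum_val j : multi_index) i).

Definition segre : ppoint F #|{: multi_index}| -> Prop :=
  fun x => exists v : forall i : 'I_k, 'rV[F]_(n i).+1,
    (forall i, v i != 0) /\ val x = <[pure_tensor v]>%VS.

Definition expected_dim (s : nat) : nat :=
  minn (\prod_(i < k) (n i).+1 - 1) (s * \sum_(i < k) n i + s - 1).

Definition segre_nondefective (s : nat) : Prop :=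
  has_dim (secant_variety s segre) (expected_dim s).

Definition segre_defective (s : nat) : Prop :=
  exists2 d : nat, (d < expected_dim s)%N & has_dim (secant_variety s segre) d.

End Segre.

Arguments segre F {k} n _.
Arguments segre_nondefective F {k} n s.
Arguments segre_defective F {k} n s.

(* Main.v *)
Require Import Defs.
From HB Require Import structures.
From mathcomp Require Import all_boot all_order all_algebra.
From mathcomp Require Import mpoly ring zify.
From Stdlib Require Import Classical.

(** Write N for the product of the n_i + 1, and let Phi be the map sending s
    tuples of vectors to the sum of the s pure tensors that they define. As F is
    infinite, a form vanishes on the s-secant variety of the Segre variety if
    and only if it vanishes on the image of Phi, so the dimension to be computed
    is that of the closure of this image, minus one.

    Upper bounds. Let P_0 < ... < P_e be a chain of primes of the homogeneous
    coordinate ring, none of which contains the irrelevant ideal; add that ideal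
    on top. If h_1, ..., h_r are algebraically independent modulo a prime Q and
    q lies in Q but not in a smaller prime P, then q, h_1, ..., h_r are
    independent modulo P (indep_mod_step). So there are e + 1 polynomials
    independent modulo P_0. Whenever a polynomial map psi in m parameters
    dominates the image of Phi, their pullbacks under psi stay independent, and
    m + 1 polynomials in m variables are dependent because there are too few
    monomials (alg_dependent); hence e < m (chain_bound). With psi the identity,
    m = N; normalizing the first coordinate of each vector to 1 gives
    m = s (sum n_i + 1). These are the two terms of the expected dimension. In
    the exceptional cases one does better. A sum of 4 pure tensors in
    F^2 x F^3 x F^(a+1) flattens to a 6 x (a+1) matrix of rank at most 4, and
    such matrices need only 24 + 4 (a - 3) parameters, so that e <= 4a + 11
    (secant_bound_flattening). In F^3 x F^3 x F^3 Strassen's 9 x 9 determinant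
    is a nonzero polynomial vanishing on the image of Phi, which loses one
    dimension (strassen_bound).

    Lower bounds. Let Phi have a Jacobian of rank r at a point p that is not in
    its zero locus. Choose a flag of linear subspaces L_1 < ... < L_r of the
    parameter space, with p in L_1, on which the differential at p is injective.
    The polynomials vanishing on Phi(L_j) form homogeneous primes P_j, and
    P_{j+1} < P_j is strict: any j + 1 polynomials on L_j are dependent, whereas
    by the Jacobian criterion in characteristic zero some j + 1 linear forms in
    the coordinates of Phi stay independent on L_{j+1}. This is a chain of length
    r - 1 (jacobian_chain). By the product rule the image of the differential
    is the sum of the tangent spaces to the Segre variety at s points, so it
    remains to choose 4 points at which this sum is as large as expected.

    Choice of the points. For k >= 5 the four points are coordinate points
    indexed by the words of a code of minimum distance 3: the Hamming balls of
    radius 1 are disjoint, and the tangent spaces are spanned by the basis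
    tensors of the balls. When coordinate points fill up the space, it is because
    their words form a covering code. The remaining cases use points
    a_l (x) b_l (x) e_l, for which the last factor cuts the problem into slices
    (sliced_injective), and for k = 4 the four even binary words of length 3
    completed by four vectors of F^3 in general position
    (even_word_injective). *)

Set Implicit Arguments.
Unset Strict Implicit.
Unset Printing Implicit Defensive.
Import GRing.Theory.
Local Open Scope ring_scope.

(** * Substitution, and polynomial functions over an infinite field *)

Notation "f \msub h" := (f \mPo [tuple h i | i < _]) (at level 50).

Section Subst.
Variables (R : comNzRingType) (n k : nat).
Implicit Types (h : 'I_n -> {mpoly R[k]}) (f : {mpoly R[n]}).

Lemma msubX h i : 'X_i \msub h = h i.
Proof. by rewrite comp_mpolyXU -tnth_nth tnth_mktuple. Qed.

Lemma msub_meval h f v : (f \msub h).@[v] = f.@[fun i => (h i).@[v]].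
Proof. by rewrite comp_mpoly_meval; apply: meval_eq => i; rewrite tnth_mktuple. Qed.

Lemma msubA l (h' : 'I_k -> {mpoly R[l]}) h f :
  f \msub h \msub h' = f \msub (fun i => h i \msub h').
Proof.
elim/mpolyind: f => [|c m f _ _ IH]; first by rewrite !raddf0.
rewrite !raddfD /= IH !linearZ /=; congr (_ *: _ + _).
rewrite mpolyXE_id !rmorph_prod /=; apply: eq_bigr => i _.
by rewrite !rmorphXn /= !comp_mpolyXU -!tnth_nth !tnth_mktuple.
Qed.

End Subst.

Lemma widen_lift_max n (i : 'I_n) : widen_ord (leqnSn n) i = lift ord_max i.
Proof. by apply/val_inj; rewrite /= /bump leqNgt ltn_ord. Qed.

(** Evaluating a polynomial in n + 1 variables can be done one variable after the
    other; this is what carries inductions on the number of variables below. *)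
Lemma mmap_muni (R : comNzRingType) (S : comNzRingType) (f : {rmorphism R -> S})
    n (h : 'I_n.+1 -> S) (p : {mpoly R[n.+1]}) :
  mmap f h p =
    (map_poly (mmap f (fun i : 'I_n => h (widen_ord (leqnSn n) i)))
       (muni p)).[h ord_max].
Proof.
rewrite muniE rmorph_sum /= horner_sum; apply: eq_bigr => m _.
rewrite -mul_polyC -mul_mpolyC rmorphM /= map_polyXn map_polyC /=.
rewrite hornerM hornerC hornerXn rmorphM /=.
rewrite mmapC mmapX /mmap1 big_ord_recr /= mulrA; congr (_ * _ * _).
by apply: eq_bigr => i _; rewrite mnmE.
Qed.

Lemma muni_eq0 (R : comNzRingType) n (p : {mpoly R[n.+1]}) : muni p = 0 -> p = 0.
Proof.
by move=> p0; rewrite -[p]comp_mpoly_id /comp_mpoly mmap_muni p0 rmorph0 horner0.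
Qed.

Section Infinite.
Variable F : fieldType.
Hypothesis charF0 : [pchar F]%R =i pred0.

Lemma natr_inj i j : i%:R = j%:R :> F -> i = j.
Proof.
wlog ij : i j / (i <= j)%N.
  by move=> W; case: (leqP i j) => [/W//|/ltnW/W H /esym/H].
move/eqP; rewrite eq_sym -subr_eq0 -natrB // ((pcharf0P F).1 charF0) subn_eq0.
by move=> ji; apply/eqP; rewrite eqn_leq ij.
Qed.

Lemma poly_nonroot (p : {poly F}) : p != 0 -> exists x, p.[x] != 0.
Proof.
move=> p0; pose s := [seq i%:R : F | i <- iota 0 (size p)].
have us : uniq s by rewrite map_inj_in_uniq ?iota_uniq // => i j _ _ /natr_inj.
case: (boolP (all (root p) s)) => [all_s|/allPn[x _ px]]; last by exists x.
by have := max_poly_roots p0 all_s us; rewrite size_map size_iota ltnn.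
Qed.

Lemma mpoly_nonroot n (f : {mpoly F[n]}) : f != 0 -> exists v, f.@[v] != 0.
Proof.
elim: n f => [|n IH] f f0.
  exists (fun=> 0); rewrite (nvar0_mpolyC f) mevalC.
  by move: f0; rewrite {1}(nvar0_mpolyC f) mpolyC_eq0.
have : lead_coef (muni f) != 0.
  by rewrite lead_coef_eq0; apply: contraNneq f0 => /muni_eq0 ->.
case/IH=> v cv.
have : map_poly (meval v) (muni f) != 0.
  by apply: contraNneq cv => H; rewrite lead_coefE -coef_map H coef0.
case/poly_nonroot => x fx.
exists (fun i : 'I_n.+1 => if unlift ord_max i is Some j then v j else x).
rewrite /meval mmap_muni unlift_none; congr (_ != _): fx; congr (_.[_]).
apply: eq_map_poly => q; apply: meval_eq => i.
by rewrite widen_lift_max liftK.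
Qed.

Lemma mpoly_eq0_meval n (f : {mpoly F[n]}) : (forall v, f.@[v] = 0) -> f = 0.
Proof.
by move=> H; apply/eqP; apply: contraT => /mpoly_nonroot[v]; rewrite H eqxx.
Qed.

End Infinite.

(** * Algebraic independence modulo a prime ideal *)

Definition indep_mod (F : fieldType) N (P : {pred {mpoly F[N]}}) r
    (h : 'I_r -> {mpoly F[N]}) :=
  forall g : {mpoly F[r]}, g \msub h \in P -> g = 0.

Definition ord_rcons T r (h : 'I_r -> T) (q : T) (i : 'I_r.+1) : T :=
  if unlift ord_max i is Some j then h j else q.

Section Step.
Variables (F : fieldType) (N : nat).
Implicit Types (P Q : {pred {mpoly F[N]}}).

(** The elementary form of the fact that the transcendence degree drops along a
    strict inclusion of primes. Write a relation as a polynomial in q with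
    coefficients in the algebra of h: since q is in Q, the constant coefficient
    is a relation modulo Q, hence zero; since q is not in P, one may then divide
    by q and repeat. *)
Lemma indep_mod_step P Q r (h : 'I_r -> {mpoly F[N]}) q :
    prime_idealr_closed P -> idealr_closed Q -> {subset P <= Q} ->
    q \in Q -> q \notin P -> indep_mod Q h ->
  indep_mod P (ord_rcons h q).
Proof.
move=> prP [_ _ Qlin] PQ qQ qP indh g.
have H (G : {poly {mpoly F[r]}}) :
    (map_poly (comp_mpoly [tuple h i | i < r]) G).[q] \in P -> G = 0.
  elim/poly_ind: G => // G c IH.
  rewrite rmorphD rmorphM /= map_polyX map_polyC /= hornerMXaddC => GP.
  have c0 : c = 0.
    apply: indh.
    have := Qlin (- (map_poly (comp_mpoly [tuple h i | i < r]) G).[q]) _ _ qQ (PQ _ GP).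
    by rewrite mulNr addKr.
  move: GP; rewrite c0 raddf0 addr0 => /prP; rewrite (negbTE qP) orbF => /IH ->.
  by rewrite mul0r add0r.
move=> gP; apply: muni_eq0; apply: H; congr (_ \in P): gP.
rewrite /comp_mpoly mmap_muni /= tnth_mktuple /ord_rcons unlift_none.
congr (_.[_]); apply: eq_map_poly => p /=; rewrite /mmap; apply: eq_bigr => m _.
congr (_ * _); apply: mmap1_eq => i; rewrite !tnth_mktuple.
by rewrite widen_lift_max liftK.
Qed.

End Step.

(** * More polynomials than variables are dependent *)

Lemma msize_mulX_le (F : fieldType) m (p q : {mpoly F[m]}) d e :
  (msize p < d)%N -> (msize (p ^+ e * q) <= e * d + msize q)%N.
Proof.
move=> pd; elim: e => [|e IH]; first by rewrite expr0 mul1r.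
rewrite exprS -mulrA mulSn -addnA; apply: leq_trans (msizeM_le _ _) _.
by rewrite -addSn leq_add.
Qed.

Lemma msize_prodX_le (F : fieldType) m r (h : 'I_r -> {mpoly F[m]}) d (e : 'I_r -> nat) D :
    (forall i, (msize (h i) < d)%N) -> (forall i, (e i <= D)%N) ->
  (msize (\prod_i h i ^+ e i) <= r * (D * d) + 1)%N.
Proof.
move=> hd eD; have -> : (r * (D * d) = \sum_(i < r) D * d)%N by rewrite sum_nat_const card_ord.
elim/big_rec2: _ => [|i k p _ IH]; first by rewrite msize1.
apply: leq_trans (msize_mulX_le _ _ (hd i)) _; rewrite -addnA leq_add //.
by rewrite leq_mul2r eD orbT.
Qed.

(** Count monomials: the (D + 1)^r products of the h_i with all exponents at most D
    have degree less than K = O(D), so they lie in a space of dimension at most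
    K^m, which is smaller than (D + 1)^r for large D because m < r. *)
Lemma alg_dependent (F : fieldType) m r (h : 'I_r -> {mpoly F[m]}) :
  (m < r)%N -> exists2 g : {mpoly F[r]}, g != 0 & g \msub h = 0.
Proof.
move=> mr; pose d := (\max_i msize (h i)).+1; pose c := (r * d + 1)%N.
have hd i : (msize (h i) < d)%N by rewrite ltnS (leq_bigmax i).
(* D + 1 > c ^ m is what makes (D + 1) ^ (m + 1) exceed ((D + 1) * c) ^ m *)
pose D := (c ^ m)%N; pose K := (r * (D * d) + 1)%N.
pose E := {ffun 'I_r -> 'I_D.+1}; pose B := {ffun 'I_m -> 'I_K}.
have cardBE : (#|{: B}| < #|{: E}|)%N.
  rewrite !card_ffun !card_ord.
  have KD : (K <= D.+1 * c)%N.
    by rewrite /K /c mulnDr muln1 leq_add // mulnCA leq_mul2r leqnSn orbT.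
  apply: (@leq_ltn_trans ((D.+1 * c) ^ m)).
    by case: (posnP m) => [->|m0]; rewrite ?expn0 ?leq_exp2r.
  apply: (@leq_trans (D.+1 ^ m.+1)); last by apply: leq_pexp2l.
  by rewrite expnMn expnS mulnC ltn_pmul2r ?expn_gt0 ?ltnSn.
pose mon (e : E) : 'X_{1..r} := [multinom (e i : nat) | i < r].
pose bmon (b : B) : 'X_{1..m} := [multinom (b i : nat) | i < m].
have mon_inj : injective mon.
  move=> e1 e2 /mnmP H; apply/ffunP => i; apply: val_inj.
  by have := H i; rewrite !mnmE.
pose A : 'M[F]_(#|{: E}|, #|{: B}|) :=
  \matrix_(a, b) ('X_[mon (enum_val a)] \msub h)@_(bmon (enum_val b)).
have : kermx A != 0.
  rewrite kermx_eq0 /row_free neq_ltn; apply/orP; left.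
  exact: leq_ltn_trans (rank_leq_col _) cardBE.
rewrite -nz_row_eq0; set x := nz_row _ => x0.
have xA : x *m A = 0 by apply/sub_kermxP; apply: nz_row_sub.
exists (\sum_a x 0 a *: 'X_[mon (enum_val a)]).
  apply: contraNneq x0 => g0; apply/eqP/rowP => a; rewrite mxE.
  have := congr1 (mcoeff (mon (enum_val a))) g0.
  rewrite raddf_sum mcoeff0 (bigD1 a) //= big1 => [|b ba].
    by rewrite addr0 mcoeffZ mcoeffX eqxx mulr1.
  by rewrite mcoeffZ mcoeffX (inj_eq mon_inj) (inj_eq enum_val_inj) (negbTE ba) mulr0.
apply/mpolyP => u; rewrite mcoeff0 [_ \msub _]raddf_sum [LHS]raddf_sum /=.
case: (ltnP (mdeg u) K) => uK.
  have uiK i : (u i < K)%N.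
    apply: leq_ltn_trans uK; rewrite mdegE (bigD1 i) //=; exact: leq_addr.
  pose b : B := [ffun i => Ordinal (uiK i)].
  have bu : bmon b = u by apply/mnmP => i; rewrite mnmE ffunE.
  transitivity ((x *m A) 0 (enum_rank b)); last by rewrite xA mxE.
  rewrite [RHS]mxE.
  by apply: eq_bigr => a _; rewrite linearZ /= mcoeffZ mxE enum_rankK bu.
apply: big1 => a _; rewrite linearZ /= mcoeffZ comp_mpolyX.
rewrite memN_msupp_eq0 ?mulr0 //; apply: msize_mdeg_ge; apply: leq_trans uK.
under eq_bigr => i _ do rewrite tnth_mktuple.
by apply: msize_prodX_le => // i; rewrite mnmE -ltnS.
Qed.

(** * The chain rule and the Jacobian criterion *)

Lemma mnm_neq0_split n (m : 'X_{1..n}) :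
  m != 0%MM -> exists i, exists m', m = (m' + U_(i))%MM.
Proof.
move=> m0; have [i mi] : exists i, (0 < m i)%N.
  apply/existsP; apply: contraNT m0; rewrite negb_exists => /forallP H.
  by apply/eqP/mnmP => i; rewrite mnm0E; have := H i; rewrite lt0n negbK => /eqP.
exists i, (m - U_(i))%MM; rewrite submK //.
by apply/mnm_lepP => l; rewrite mnm1E; case: eqP => // <-.
Qed.

Lemma mderivXU (R : nzRingType) n (i j : 'I_n) :
  mderiv j ('X_i : {mpoly R[n]}) = (i == j)%:R.
Proof.
rewrite mderivX mnm1E; have [->|ij] := eqVneq i j; last by rewrite scale0r.
by rewrite -[X in (X - _)%MM]add0m addmK mpolyX0 scale1r.
Qed.

Lemma mderiv_prod (R : comNzRingType) n i (I : eqType) (r : seq I)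
    (f : I -> {mpoly R[n]}) : uniq r ->
  mderiv i (\prod_(j <- r) f j) =
   \sum_(j <- r) mderiv i (f j) * \prod_(k <- r | k != j) f k.
Proof.
elim: r => [|a r IH] /=; first by rewrite !big_nil -mpolyC1 mderivC.
case/andP => ar ur; rewrite !big_cons mderivM IH // eqxx /=; congr (_ * _ + _).
  rewrite big_seq [RHS]big_seq_cond; apply: eq_bigl => j.
  by case: (boolP (j \in r)) => //= jr; apply/esym; apply: contraNneq ar => <-.
rewrite mulr_sumr; apply: eq_big_seq => j jr.
rewrite big_cons; have -> : a != j by apply: contraNneq ar => ->.
by rewrite mulrCA.
Qed.

Lemma mderiv_msub (R : comNzRingType) n k (h : 'I_n -> {mpoly R[k]}) f j :
  mderiv j (f \msub h) = \sum_i (mderiv i f \msub h) * mderiv j (h i).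
Proof.
elim/mpolyind: f => [|c m f _ _ IH].
  by rewrite !raddf0 big1 // => i _; rewrite !raddf0 mul0r.
rewrite !raddfD /= IH.
under [RHS]eq_bigr => i _ do rewrite !raddfD /= mulrDl.
rewrite big_split /=; congr (_ + _).
under eq_bigr => i _ do rewrite !linearZ /= -scalerAl.
rewrite !linearZ /= -scaler_sumr; congr (_ *: _) => {IH f c}.
have [k0 mk] := ubnP (mdeg m); elim: k0 m mk => // k0 IH m mk.
have [->|m0] := eqVneq m 0%MM.
  rewrite mpolyX0 rmorph1 -mpolyC1 mderivC big1 // => i _.
  by rewrite -mpolyC1 mderivC raddf0 mul0r.
have [i [m' Em]] := mnm_neq0_split m0.
have m'k : (mdeg m' < k0)%N.
  by rewrite -ltnS (leq_trans _ mk) // Em mdegD mdeg1 addn1.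
rewrite Em addmC mpolyXD rmorphM /= mderivM (IH m') // msubX.
under [RHS]eq_bigr => l _ do rewrite mderivM raddfD /= !rmorphM /= mulrDl msubX.
rewrite big_split /=; congr (_ + _); last first.
  by rewrite mulr_sumr; apply: eq_bigr => l _; rewrite mulrA.
rewrite (bigD1 i) //= big1 => [|l li].
  rewrite addr0 mderivXU eqxx rmorph1 mul1r.
  by rewrite mulrC.
by rewrite mderivXU eq_sym (negbTE li) rmorph0 !mul0r.
Qed.

Lemma msize_mderiv (R : idomainType) n (g : {mpoly R[n]}) i :
  g != 0 -> (msize (mderiv i g) < msize g)%N.
Proof.
move=> g0; rewrite (mpolySpred mdeg g0) ltnS msizeE.
apply/bigmax_leqP_seq => m; rewrite mcoeff_msupp mcoeff_mderiv => mg _.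
have : (m + U_(i))%MM \in msupp g.
  by rewrite mcoeff_msupp; apply: contraNneq mg => ->; rewrite mul0rn.
by move/msize_mdeg_lt; rewrite mdegD mdeg1 addn1 (mpolySpred mdeg g0) ltnS.
Qed.

(** Take a relation g of least degree. Differentiating g(h) = 0 shows that the
    vector of the (d_i g)(h) is killed by the Jacobian matrix, whose determinant
    is nonzero; so the d_i g are relations of smaller degree, hence zero, and in
    characteristic zero g is constant. *)
Lemma jacobian_independent (F : fieldType) (charF0 : [pchar F] =i pred0) r
    (h : 'I_r -> {mpoly F[r]}) (a : 'I_r -> F) :
    \det (\matrix_(i, j) (mderiv j (h i)).@[a]) != 0 ->
  forall g : {mpoly F[r]}, g \msub h = 0 -> g = 0.
Proof.
move=> det0 g.
have [k gk] := ubnP (msize g); elim: k g gk => // k IH g gk gh0.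
pose J : 'M[{mpoly F[r]}]_r := \matrix_(i, j) mderiv j (h i).
have detJ : \det J != 0.
  apply: contraNneq det0 => J0.
  have -> : \matrix_(i, j) (mderiv j (h i)).@[a] = map_mx (meval a) J.
    by apply/matrixP => i j; rewrite !mxE.
  by rewrite det_map_mx /= J0 meval0.
have [//|g0] := eqVneq g 0.
have dg0 i : mderiv i g = 0.
  apply: IH; first by rewrite -ltnS (leq_trans _ gk) // ltnS msize_mderiv.
  pose x : 'rV[{mpoly F[r]}]_r := \row_i (mderiv i g \msub h).
  have xJ : x *m J = 0.
    apply/rowP => j; rewrite !mxE; have := congr1 (mderiv j) gh0.
    rewrite mderiv_msub mderiv0 => dgh0; rewrite -[RHS]dgh0; apply: eq_bigr => l _.
    by rewrite !mxE.
  have : x *m (J *m \adj J) = 0 by rewrite mulmxA xJ mul0mx.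
  rewrite mul_mx_adj mul_mx_scalar => /rowP/(_ i); rewrite !mxE => /eqP.
  by rewrite mulf_eq0 (negbTE detJ) => /eqP.
have gC : g = (g@_0%MM)%:MP.
  apply/mpolyP => m; rewrite mcoeffC.
  have [->|m0] := eqVneq m 0%MM; first by rewrite mulr1.
  have [i [m' Em]] := mnm_neq0_split m0.
  have := congr1 (mcoeff m') (dg0 i).
  rewrite mcoeff_mderiv -Em mcoeff0 mulr0 -mulr_natr => /eqP.
  by rewrite mulf_eq0 ((pcharf0P F).1 charF0) orbF => /eqP.
by move: gh0; rewrite gC comp_mpolyC => /eqP; rewrite mpolyC_eq0 => /eqP ->; rewrite mpolyC0.
Qed.

(** * Chains of primes: bounds from above *)

Section UpperBound.
Variables (F : fieldType) (N : nat).
Implicit Types (Z : ppoint F N -> Prop) (P : {pred {mpoly F[N]}}).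

Lemma pihomog0E (f : {mpoly F[N]}) : pihomog mdeg 0 f = (f@_0%MM)%:MP.
Proof.
elim/mpolyind: f => [|c m f _ _ IH]; first by rewrite !raddf0.
rewrite !raddfD /= IH mcoeffZ mcoeffX linearZ /= pihomogX mdeg_eq0; congr (_ + _).
have [->|_] := eqVneq; last by rewrite scaler0 mulr0 mpolyC0.
by rewrite mpolyX0 mulr1 -alg_mpolyC.
Qed.

Lemma idealr_sum P (I : Type) (r : seq I) (f : I -> {mpoly F[N]}) :
  idealr_closed P -> (forall i, f i \in P) -> \sum_(i <- r) f i \in P.
Proof.
case=> P0 _ PD fP; elim: r => [|i r IH]; first by rewrite big_nil.
by rewrite big_cons -[f i]mul1r PD.
Qed.

(** A homogeneous prime contains the constant terms of its elements, so it lies in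
    the irrelevant ideal. *)
Lemma proj_prime_constants Z P f : proj_prime Z P -> f \in P -> f@_0%MM = 0.
Proof.
case=> [[P0 P1 PD] _ Ph _ _] fP; apply: contraNeq P1 => f0.
have := PD ((f@_0%MM)^-1)%:MP _ _ (Ph 0%N _ fP) P0.
by rewrite pihomog0E -mpolyCM mulVf // addr0 mpolyC1.
Qed.

Lemma irrelevant_ideal : idealr_closed [pred f : {mpoly F[N]} | f@_0%MM == 0].
Proof.
split=> [||a u v]; rewrite ?inE ?mcoeff0 // ?mcoeff1 ?eqxx ?oner_eq0 //.
by move=> /eqP u0 /eqP v0; rewrite mcoeffD rmorphM /= u0 v0 mulr0 addr0.
Qed.

(** Each step of the chain contributes one polynomial. Adding the irrelevant ideal
    as a top step, which is strict since some variable is not in the last prime,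
    gives the extra one. *)
Lemma chain_independent Z e : has_chain Z e ->
  exists P, proj_prime Z P /\ exists h : 'I_e.+1 -> {mpoly F[N]}, indep_mod P h.
Proof.
case=> P [Pprime Pinc]; exists (P ord0); split=> //.
suff H i : (i <= e)%N ->
    exists h : 'I_i.+1 -> {mpoly F[N]}, indep_mod (P (inord (e - i))) h.
  have [h] := H e (leqnn e); rewrite subnn.
  have -> : inord 0 = ord0 :> 'I_e.+1 by apply: val_inj; rewrite /= inordK.
  by exists h.
elim: i => [|i IH] ie.
  have [x Px] : exists x, 'X_x \notin P (inord (e - 0)) by case: (Pprime (inord (e - 0))).
  have [_ prP _ _ _] := Pprime (inord (e - 0)).
  pose h0 (i : 'I_0) : {mpoly F[N]} := 0.
  exists (ord_rcons h0 'X_x).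
  apply: indep_mod_step prP irrelevant_ideal _ _ Px _.
  - by move=> f fP; rewrite inE (proj_prime_constants (Pprime _) fP).
  - by rewrite inE mcoeffX mnm1_eq0.
  - move=> g; rewrite (nvar0_mpolyC g) comp_mpolyC inE mcoeffC eqxx mulr1 => /eqP ->.
    by rewrite mpolyC0.
have [h indh] := IH (ltnW ie).
have [|sub [q qQ qP]] := Pinc (inord (e - i.+1)) (inord (e - i)).
  by rewrite !inordK ?ltnS ?leq_subr // ltn_sub2l.
exists (ord_rcons h q).
have [_ prP _ _ _] := Pprime (inord (e - i.+1)).
have [idQ _ _ _ _] := Pprime (inord (e - i)).
exact: indep_mod_step prP idQ sub qQ qP indh.
Qed.

(** The hypothesis on psi says that the cone over Z lies in the closure of its
    image. *)
Lemma chain_bound Z e m (psi : 'I_N -> {mpoly F[m]}) :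
    (forall f, f \msub psi = 0 -> forall d, vanishes_on (pihomog mdeg d f) Z) ->
  has_chain Z e -> (e < m)%N.
Proof.
move=> psiZ /chain_independent[P [primeP [h indh]]]; rewrite ltnNge; apply/negP => me.
have [g g0 gh] := alg_dependent (fun i => h i \msub psi) me.
case/eqP: g0; apply: indh; have [idP _ _ _ PZ] := primeP.
rewrite [_ \msub _](pihomog_partitionE (mf := mdeg) (leqnn _)) idealr_sum // => d.
apply: PZ (pihomogP _ _ _) _; apply: psiZ.
by rewrite msubA.
Qed.

(** A nonzero q in the ideal of Z makes one more strict step, from the zero ideal
    to the first prime of the chain. *)
Lemma chain_bound_hypersurface Z e (q : {mpoly F[N]}) :
    q != 0 -> (forall d, vanishes_on (pihomog mdeg d q) Z) ->
  has_chain Z e -> (e.+1 < N)%N.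
Proof.
move=> q0 qZ /chain_independent[P [primeP [h indh]]].
have [idP _ _ _ PZ] := primeP.
rewrite ltnNge; apply/negP => me.
have [g g0 gh] := alg_dependent (ord_rcons h q) (me : N < e.+2)%N.
case/eqP: g0; apply: (@indep_mod_step _ _ (pred1 0) P _ h q) => //.
- by move=> u v; rewrite !inE mulf_eq0.
- by move=> f; rewrite inE => /eqP ->; case: idP.
- rewrite [q](pihomog_partitionE (mf := mdeg) (leqnn _)) idealr_sum // => d.
  exact: PZ (pihomogP _ _ _) (qZ d).
- by rewrite inE gh.
Qed.

End UpperBound.

(** * Chains of primes: construction from the Jacobian *)

Section Homogeneous.
Variable F : fieldType.
Hypothesis charF0 : [pchar F]%R =i pred0.
Variable N : nat.

Lemma meval_homog d (f : {mpoly F[N]}) (c : F) z :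
  f \is d.-homog -> f.@[fun i => c * z i] = c ^+ d * f.@[z].
Proof.
move/dhomogP => fd; rewrite !mevalE mulr_sumr; apply: eq_big_seq => m /fd /= md.
rewrite mulrCA; congr (_ * _); rewrite -md mdegE.
by under eq_bigr do rewrite exprMn; rewrite big_split /= prodrXr.
Qed.

(** The values f(c^k z) are those of a polynomial in c whose coefficient of degree
    k d is f_d(z), and a polynomial that vanishes on an infinite field is zero. *)
Lemma homog_component_vanish k (f : {mpoly F[N]}) z : (0 < k)%N ->
    (forall c, f.@[fun i => c ^+ k * z i] = 0) ->
  forall d, (pihomog mdeg d f).@[z] = 0.
Proof.
move=> k0 fz d; pose D := maxn (msize f) d.+1.
pose q : {poly F} := \sum_(i < D) ((pihomog mdeg i f).@[z] *: 'X^(k * i)).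
have q0 : q = 0.
  apply/eqP; apply: contraT => /(poly_nonroot charF0) [c].
  rewrite -(fz c) [in X in _ != X](pihomog_partitionE (leq_maxl _ _ : _ <= D)%N).
  rewrite raddf_sum horner_sum /=; case/eqP; apply: eq_bigr => i _.
  by rewrite hornerZ hornerXn (meval_homog _ _ (pihomogP _ _ _)) -exprM mulrC.
have dD : (d < D)%N by rewrite leq_max leqnn orbT.
have := congr1 (fun q : {poly F} => q`_(k * d)) q0.
rewrite coef0 coef_sum (bigD1 (Ordinal dD)) //= big1 => [|i id].
  by rewrite addr0 coefZ coefXn eqxx mulr1.
rewrite coefZ coefXn eqn_mul2l -[k == 0]negbK -lt0n k0 /= eq_sym.
by rewrite -val_eqE /= in id; rewrite (negbTE id) mulr0.
Qed.

End Homogeneous.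

Section LowerBound.
Variable F : fieldType.
Hypothesis charF0 : [pchar F]%R =i pred0.
Variables (N M k : nat) (Z : ppoint F N -> Prop) (phi : 'I_N -> {mpoly F[M]}).
Hypothesis k_gt0 : (0 < k)%N.
Hypothesis phi_homog : forall x c t, (phi x).@[fun i => c * t i] = c ^+ k * (phi x).@[t].
Hypothesis phiZ : forall d (f : {mpoly F[N]}), f \is d.-homog -> vanishes_on f Z ->
  forall t, f.@[fun x => (phi x).@[t]] = 0.

(** The flag is given by its successive directions u_0, u_1, ...; u_0 is at the
    same time the point where the differential is taken. L j parametrizes the
    span of the first j directions, and K j is the ideal of its image. *)
Section Flag.
Variables (u : nat -> 'I_M -> F) (r : nat).
Hypothesis phi_u0 : exists x, (phi x).@[u 0%N] != 0.
Hypothesis free_u :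
  row_free (\matrix_(i < r, x < N) \sum_t u i t * (mderiv t (phi x)).@[u 0%N]).

Let L j (t : 'I_M) : {mpoly F[j]} := \sum_(i < j) u i t *: 'X_i.
Let K j : {pred {mpoly F[N]}} := [pred f | f \msub phi \msub L j == 0].

Let LE j (s : nat -> F) t : (L j t).@[fun i => s i] = \sum_(i < j) s i * u i t.
Proof.
rewrite raddf_sum /=; apply: eq_bigr => i _.
by rewrite mevalZ mevalXU mulrC.
Qed.

Let KP j f : reflect
  (forall s : nat -> F,
    f.@[fun x => (phi x).@[fun t => \sum_(i < j) s i * u i t]] = 0)
  (f \in K j).
Proof.
have E (s : nat -> F) : f.@[fun x => (phi x).@[fun t => \sum_(i < j) s i * u i t]] =
    (f \msub phi \msub L j).@[fun i => s i].
  rewrite !msub_meval; apply: meval_eq => x; apply: meval_eq => t.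
  by rewrite LE.
apply: (iffP eqP) => [fK s|fK]; first by rewrite E fK meval0.
apply: (mpoly_eq0_meval charF0) => v.
pose s i := if insub i is Some i' then v i' else 0.
by rewrite -[RHS](fK s) E; apply: meval_eq => i; rewrite /s valK.
Qed.

Let K_prime j : (0 < j)%N -> proj_prime Z (K j).
Proof.
move=> j0; split.
- split; rewrite ?inE ?rmorph0 // ?rmorph1 ?oner_eq0 // => a f g.
  by rewrite !inE !rmorphD !rmorphM /= => /eqP -> /eqP ->; rewrite mulr0 addr0.
- by move=> f g; rewrite !inE !rmorphM mulf_eq0.
- move=> d f /KP fK; apply/KP => s; apply: (homog_component_vanish charF0 k_gt0) => c.
  rewrite -[RHS](fK (fun i => c * s i)); apply: meval_eq => x.
  rewrite -phi_homog; apply: meval_eq => t; rewrite mulr_sumr.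
  by apply: eq_bigr => i _; rewrite mulrA.
- have [x px] := phi_u0; exists x; apply/negP => /KP /(_ (fun i => (i == 0%N)%:R)).
  rewrite mevalXU => H; case/eqP: px; rewrite -[RHS]H; apply: meval_eq => t.
  rewrite -(prednK j0) big_ord_recl mul1r big1 ?addr0 // => i _.
  by rewrite mul0r.
- by move=> d f fd fZ; apply/KP => s; apply: phiZ fd fZ _.
Qed.

Let K_mono a b : (a <= b)%N -> {subset K b <= K a}.
Proof.
move=> ab f /KP fK; apply/KP => s.
rewrite -[RHS](fK (fun i => if (i < a)%N then s i else 0)).
apply: meval_eq => x; apply: meval_eq => t.
rewrite (big_ord_widen _ (fun i => s i * u i t) ab) big_mkcond; apply: eq_bigr => i _.
by case: ifP => //; rewrite mul0r.
Qed.

(** B takes j + 1 linear forms y on the target that are dual to the first j + 1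
    columns of the differential. They satisfy a relation g on the j-dimensional
    step; if g(y) were in K (j + 1) too, then g would be a relation between j + 1
    polynomials whose Jacobian matrix at u_0 is the identity. *)
Let K_strict j : (j < r)%N -> exists2 f, f \in K j & f \notin K j.+1.
Proof.
move=> jr; have /row_freeP[B AB] := free_u.
pose y (i : 'I_j.+1) : {mpoly F[N]} := \sum_x B x (widen_ord jr i) *: 'X_x.
have [g g0 gK] := alg_dependent (fun i => y i \msub phi \msub L j) (ltnSn j).
have gE i : g \msub y \msub phi \msub L i =
    g \msub (fun l => y l \msub phi \msub L i).
  by rewrite (msubA phi y g) msubA.
exists (g \msub y); first by rewrite inE gE gK.
rewrite inE gE; apply: contraNneq g0 => gK1; apply/eqP; move: gK1.
pose a (i : 'I_j.+1) : F := ((i : nat) == 0%N)%:R.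
apply: (jacobian_independent charF0 (a := a)).
set J := (X in \det X); suff -> : J = 1%:M by rewrite det1 oner_eq0.
apply/matrixP => i i'; rewrite !mxE.
have := congr1 (fun A : 'M_r => A (widen_ord jr i') (widen_ord jr i)) AB; rewrite !mxE.
have -> : (widen_ord jr i' == widen_ord jr i) = (i == i') by rewrite eq_sym.
move=> <-; rewrite mderiv_msub raddf_sum /=.
under [RHS]eq_bigr => x _ do rewrite mxE mulr_suml.
rewrite exchange_big /=; apply: eq_bigr => t _.
have La l : (L j.+1 l).@[a] = u 0%N l.
  rewrite (LE j.+1 (fun i => (i == 0%N)%:R)) big_ord_recl mul1r big1 ?addr0 // => l' _.
  by rewrite mul0r.
rewrite rmorphM /= msub_meval.
have -> : (mderiv i' (L j.+1 t)).@[a] = u i' t.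
  rewrite /L [mderiv _ _]raddf_sum [LHS]raddf_sum (bigD1 i') //= big1 => [|l li].
    by rewrite linearZ /= mderivXU eqxx mevalZ meval1 mulr1 addr0.
  by rewrite linearZ /= mderivXU (negbTE li) mevalZ meval0 mulr0.
rewrite (meval_eq _ La) [mderiv _ _]mderiv_msub raddf_sum mulr_suml; apply: eq_bigr => x _.
have yx : mderiv x (y i) = (B x (widen_ord jr i))%:MP.
  rewrite /y [LHS]raddf_sum (bigD1 x) //= big1 => [|l li].
    by rewrite linearZ /= mderivXU eqxx addr0 -alg_mpolyC.
  by rewrite linearZ /= mderivXU (negbTE li) scaler0.
by rewrite yx comp_mpolyC /= mevalM mevalC mulrC [B _ _ * _]mulrC mulrA.
Qed.

Lemma flag_chain : (0 < r)%N -> has_chain Z r.-1.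
Proof.
move=> r0; exists (fun i => K (r - i)%N); split=> [i|i j ij].
  by apply: K_prime; rewrite subn_gt0 (leq_trans (ltn_ord i)) // prednK.
have jr : (j < r)%N by rewrite (leq_trans (ltn_ord j)) // prednK.
split; first by apply: K_mono; rewrite leq_sub2l // ltnW.
have [|f fj fj1] := @K_strict (r - j); first by rewrite ltn_subrL (leq_ltn_trans _ ij) // r0.
exists f => //; apply: contra fj1; apply: K_mono.
by rewrite ltn_sub2l // (ltn_trans ij).
Qed.

End Flag.

(** By Euler's identity the direction p itself has nonzero image under the
    differential, so it can be completed to a flag of length the rank. *)
Lemma jacobian_chain (p : 'I_M -> F) :
    (exists x, (phi x).@[p] != 0) ->
    (forall x, \sum_t p t * (mderiv t (phi x)).@[p] = k%:R * (phi x).@[p]) ->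
  has_chain Z (\rank (\matrix_(t < M, x < N) (mderiv t (phi x)).@[p])).-1.
Proof.
move=> [x0 px0] euler; set J := (X in \rank X).
pose p0 : 'rV[F]_M := \row_t p t; pose w := p0 *m J.
have wE x : w 0 x = k%:R * (phi x).@[p].
  by rewrite mxE -euler; apply: eq_bigr => t _; rewrite !mxE.
have w0 : \rank w = 1%N.
  rewrite rank_rV; case: eqVneq => // /rowP/(_ x0); rewrite wE mxE => /eqP.
  rewrite mulf_eq0 (negbTE px0) orbF ((pcharf0P F).1 charF0).
  by rewrite -[_ == _]negbK -lt0n k_gt0.
have wJ : (w <= J)%MS by apply: submxMl.
(* D complements the image w of p in the image of the differential *)
pose D := (J :\: w)%MS.
have rankD : (1 + \rank D)%N = \rank J.
  by rewrite -(mxrank_cap_compl J w) (capmx_idPr wJ) w0.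
have /submxP[Y YE] : (row_base D <= J)%MS by rewrite eq_row_base diffmxSl.
pose X : 'M_(1 + \rank D, M) := col_mx p0 Y.
have XJ : row_free (X *m J).
  rewrite /row_free mul_col_mx -YE -addsmxE rankD -(addsmx_diff_cap_eq J w).
  rewrite (adds_eqmx (eqmx_refl w) (eq_row_base D)).
  by rewrite (adds_eqmx (eqmx_refl D) (capmx_idPr wJ)) addsmxC.
pose u i t : F := if insub i is Some i' then X i' t else 0.
have uE (i : 'I_(1 + \rank D)) t : u i t = X i t by rewrite /u valK.
have u0 t : u 0%N t = p t.
  by rewrite (uE (lshift _ 0)) col_mxEu mxE.
rewrite -rankD; apply: (@flag_chain u) => //.
  by exists x0; rewrite (meval_eq _ u0).
move: XJ; congr (is_true (row_free _)); apply/matrixP => i x; rewrite !mxE.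
by apply: eq_bigr => t _; rewrite uE !mxE (meval_eq _ u0).
Qed.

End LowerBound.

(** * Sums of pure tensors and their differential *)

(** Vectors and multi-indices are functions on nat, of which only the values in
    range matter: v l i b is the coordinate b of the vector in factor i of the
    l-th pure tensor. This avoids dependent types when explicit points are
    chosen. *)
Section Coordinates.
Variables (F : fieldType) (s k : nat).
Implicit Types (v y : nat -> nat -> nat -> F) (j : nat -> nat).

Definition tensor_sum v j : F := \sum_(l < s) \prod_(i < k) v l i (j i).

(** The differential of tensor_sum at v in the direction y. *)
Definition tangent v y j : F :=
  \sum_(l < s) \sum_(i < k) y l i (j i) * \prod_(i' < k | i' != i) v l i' (j i').

Lemma tangent_self v j : tangent v v j = k%:R * tensor_sum v j.
Proof.
rewrite mulr_sumr; apply: eq_bigr => l _.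
under eq_bigr => i _ do rewrite -(bigD1 (P := xpredT) i) //=.
by rewrite sumr_const card_ord mulr_natl.
Qed.

End Coordinates.

(** For k > 1 the differential is not injective at nonzero vectors: the s (k - 1)
    rescalings of the vectors of one pure tensor against each other do not move it.
    They are ruled out by fixing, for each l and each factor i but i0, the
    coordinate of index anchor l i. Injectivity then means that the s tangent
    spaces are independent. *)
Definition tangent_injective (F : fieldType) s k (n : 'I_k -> nat)
    (v : nat -> nat -> nat -> F) (anchor : nat -> nat -> nat) (i0 : 'I_k) :=
  forall y, (forall j : nat -> nat, (forall i : 'I_k, (j i <= n i)%N) ->
      tangent s k v y j = 0) ->
    (forall (l : 'I_s) (i : 'I_k), i != i0 -> y l i (anchor l i) = 0) ->
    forall (l : 'I_s) (i : 'I_k) b, (b <= n i)%N -> y l i b = 0.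

(** It suffices to reach the basis tensors. *)
Definition tangent_surjective (F : fieldType) s k (n : 'I_k -> nat)
    (v : nat -> nat -> nat -> F) :=
  forall j : nat -> nat, (forall i : 'I_k, (j i <= n i)%N) ->
    exists y, forall j' : nat -> nat, (forall i : 'I_k, (j' i <= n i)%N) ->
      tangent s k v y j' = [forall i : 'I_k, j' i == j i]%:R.

Definition unit_direction (F : fieldType) (l0 i0 b0 l i b : nat) : F :=
  ((l == l0) && (i == i0) && (b == b0))%:R.

Lemma tangent_unit (F : fieldType) s k (v : nat -> nat -> nat -> F)
    (l : 'I_s) (i : 'I_k) b j :
  tangent s k v (unit_direction F l i b) j =
    (j i == b)%:R * \prod_(i' < k | i' != i) v l i' (j i').
Proof.
rewrite /tangent (bigD1 l) //= [X in _ + X]big1 ?addr0 => [|l' /negbTE l'l]; last first.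
  by apply: big1 => i' _; rewrite /unit_direction val_eqE l'l mul0r.
rewrite (bigD1 i) //= [X in _ + X]big1 ?addr0 => [|i' /negbTE i'i]; last first.
  by rewrite /unit_direction !val_eqE i'i andbF mul0r.
by rewrite /unit_direction !eqxx.
Qed.

Lemma tangent_linear (F : fieldType) s k (v : nat -> nat -> nat -> F)
    (a b : F) y z j :
  tangent s k v (fun l i x => a * y l i x + b * z l i x) j =
    a * tangent s k v y j + b * tangent s k v z j.
Proof.
rewrite /tangent !mulr_sumr -big_split; apply: eq_bigr => l _.
rewrite !mulr_sumr -big_split; apply: eq_bigr => i _ /=.
by rewrite mulrDl !mulrA.
Qed.

Lemma card_multi_index k (n : 'I_k -> nat) :
  #|{: multi_index n}| = (\prod_(i < k) (n i).+1)%N.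
Proof.
rewrite card_dep_ffun foldrE big_map big_enum.
by apply: eq_bigr => i _; rewrite card_ord.
Qed.

Section SecantSegre.
Variable F : fieldType.
Hypothesis charF0 : [pchar F]%R =i pred0.
Variables (s k : nat) (n : 'I_k -> nat).
Hypothesis s_gt0 : (0 < s)%N.
Hypothesis k_gt0 : (0 < k)%N.
Implicit Types (v y : nat -> nat -> nat -> F).

Local Notation N := #|{: multi_index n}|.
Local Notation Z := (secant_variety s (segre F n)).

(** The coordinates on the target are numbered; this is the multi-index of a
    number, as a function on nat. *)
Definition nat_index (x : 'I_N) (i : nat) : nat :=
  if (insub i : option 'I_k) is Some i' then (enum_val x : multi_index n) i' else 0%N.

Lemma nat_indexE x (i : 'I_k) : nat_index x i = (enum_val x : multi_index n) i.
Proof. by rewrite /nat_index valK. Qed.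

Lemma nat_index_le x (i : 'I_k) : (nat_index x i <= n i)%N.
Proof. by rewrite nat_indexE -ltnS. Qed.

Lemma nat_index_surj (j : nat -> nat) : (forall i : 'I_k, (j i <= n i)%N) ->
  exists x, forall i : 'I_k, nat_index x i = j i.
Proof.
move=> jn; pose m : multi_index n := [ffun i => inord (j i) : 'I_(n i).+1].
exists (enum_rank m) => i; rewrite nat_indexE enum_rankK ffunE inordK //.
by rewrite ltnS.
Qed.

Lemma nat_index_inj x x' : (forall i : 'I_k, nat_index x i = nat_index x' i) -> x = x'.
Proof.
move=> H; apply: enum_val_inj; apply/ffunP => i; apply: val_inj.
by have := H i; rewrite !nat_indexE.
Qed.

Lemma eq_tensor_sum v (j j' : nat -> nat) : (forall i : 'I_k, j i = j' i) ->
  tensor_sum s k v j = tensor_sum s k v j'.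
Proof.
by move=> jj'; apply: eq_bigr => l _; apply: eq_bigr => i _; rewrite jj'.
Qed.

Lemma eq_tangent v y (j j' : nat -> nat) : (forall i : 'I_k, j i = j' i) ->
  tangent s k v y j = tangent s k v y j'.
Proof.
move=> jj'; apply: eq_bigr => l _; apply: eq_bigr => i _; rewrite jj'.
by congr (_ * _); apply: eq_bigr => i' _; rewrite jj'.
Qed.

(** The scalars a l are absorbed in the vectors of the first factor. *)
Let extend (w : 'I_s -> forall i : 'I_k, 'rV[F]_(n i).+1) (a : 'I_s -> F)
    (l i b : nat) : F :=
  if (insub l : option 'I_s) is Some l' then
    if (insub i : option 'I_k) is Some i' then
      (if i' == 0%N :> nat then a l' else 1) * w l' i' 0 (inord b)
    else 0
  else 0.

Let extendE w a x :
  tensor_sum s k (extend w a) (nat_index x) = \sum_l a l * (pure_tensor (w l)) 0 x.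
Proof.
apply: eq_bigr => l _; rewrite mxE.
under eq_bigr => i _ do rewrite /extend !valK nat_indexE inord_val.
rewrite big_split /=; congr (_ * _).
rewrite (bigD1 (Ordinal k_gt0)) //= big1 ?mulr1 // => i.
by rewrite -val_eqE /= => /negbTE ->.
Qed.

(** The sums of s pure tensors form a cone, so that the homogeneous components of f
    vanish on it with f. *)
Lemma vanish_on_secant (f : {mpoly F[N]}) :
    (forall v, f.@[fun x => tensor_sum s k v (nat_index x)] = 0) ->
  forall d, vanishes_on (pihomog mdeg d f) Z.
Proof.
move=> fv d y yZ; apply: (yZ _ _ (pihomogP _ _ _)).
move=> {y yZ} y [x [xS yx]] w wy.
have [u uP] : exists u : 'I_s -> forall i : 'I_k, 'rV[F]_(n i).+1,
    forall l, val (x l) = <[pure_tensor (u l)]>%VS.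
  apply: (fin_all_exists (P := fun l u => val (x l) = <[pure_tensor u]>%VS)) => l.
  by have [u [_ ux]] := xS l; exists u.
have /memv_sumP[w' w'x wE] := subvP yx w wy.
have [a aP] : exists a : 'I_s -> F, forall l, w' l = a l *: pure_tensor (u l).
  apply: (fin_all_exists (P := fun l c => w' l = c *: pure_tensor (u l))) => l.
  by have := w'x l isT; rewrite uP => /vlineP[c ->]; exists c.
apply: (homog_component_vanish charF0 (ltn0Sn 0)) => c; rewrite expr1.
rewrite -[RHS](fv (extend u (fun l => c * a l))); apply: meval_eq => i.
rewrite extendE wE summxE mulr_sumr; apply: eq_bigr => l _.
by rewrite aP mxE mulrA.
Qed.

Lemma pure_tensor_neq0 (w : forall i : 'I_k, 'rV[F]_(n i).+1) :
  (forall i, w i != 0) -> pure_tensor w != 0.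
Proof.
move=> w0.
have b i : {b : 'I_(n i).+1 | w i 0 b != 0}.
  apply: sigW; apply/existsP; apply: contraNT (w0 i); rewrite negb_exists => /forallP H.
  by apply/eqP/rowP => b; rewrite mxE; have := H b; rewrite negbK => /eqP.
pose m : multi_index n := [ffun i => sval (b i) : 'I_(n i).+1].
apply/eqP => /rowP/(_ (enum_rank m)); rewrite !mxE enum_rankK => /eqP.
rewrite prodf_seq_eq0 => /hasP[i _ /= /eqP]; rewrite ffunE.
by have := svalP (b i) => /eqP.
Qed.

Lemma line_dim (w : 'rV[F]_N) : w != 0 -> \dim <[w]>%VS == 1%N.
Proof. by rewrite dim_vline => ->. Qed.

Definition line (w : 'rV[F]_N) (w0 : w != 0) : ppoint F N :=
  exist _ <[w]>%VS (line_dim w0).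

(** When one of the vectors is zero, its pure tensor is not a point of the Segre
    variety, but the sum is still in the span of s points of it; when the sum
    itself is zero, homogeneity reduces the value of f to that at another point. *)
Lemma secant_vanish d (f : {mpoly F[N]}) : f \is d.-homog -> vanishes_on f Z ->
  forall v, f.@[fun x => tensor_sum s k v (nat_index x)] = 0.
Proof.
move=> fd fZ v.
have Zspan (x : 'I_s -> ppoint F N) (w : 'rV[F]_N) : (forall l, segre F n (x l)) ->
    w != 0 -> w \in span_points x -> f.@[fun i => w 0 i] = 0.
  move=> xS w0 wx; apply: (fZ (line w0)); last exact: memv_line.
  move=> e g ge; apply; exists x; split; [exact: xS | exact: wx].
pose ones i : 'rV[F]_(n i).+1 := const_mx 1.
have ones0 i : ones i != 0.
  by apply/eqP => /rowP/(_ 0); rewrite !mxE => /eqP; rewrite oner_eq0.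
have pones0 := pure_tensor_neq0 ones0.
have [wE|wN] := eqVneq (\row_x tensor_sum s k v (nat_index x)) 0.
  have f1 : f.@[fun x => pure_tensor ones 0 x] = 0.
    apply: (Zspan (fun=> line pones0)) => [l||]; first by exists ones.
    - exact: pones0.
    - by rewrite memvE /span_points (bigD1 (Ordinal s_gt0)) //= addvSl.
  transitivity (0 ^+ d * f.@[fun x => pure_tensor ones 0 x]); last by rewrite f1 mulr0.
  rewrite -(meval_homog _ _ fd).
  apply: meval_eq => x; have := congr1 (fun w : 'rV_N => w 0 x) wE.
  by rewrite !mxE mul0r.
pose row l i : 'rV[F]_(n i).+1 := \row_b v l i b.
pose u (l : 'I_s) := if [forall i, row l i != 0] then row l else ones.
have u0 l i : u l i != 0.
  by rewrite /u; case: ifP => // /forallP /(_ i).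
have uS l : pure_tensor (u l) != 0 by apply: pure_tensor_neq0.
transitivity f.@[fun x => (\row_x tensor_sum s k v (nat_index x)) 0 x].
  by apply: meval_eq => x; rewrite mxE.
apply: (Zspan (fun l => line (uS l))) => //.
  by move=> l; exists (u l).
have -> : \row_x tensor_sum s k v (nat_index x) = \sum_(l < s) pure_tensor (row l).
  apply/rowP => x; rewrite mxE summxE; apply: eq_bigr => l _; rewrite mxE.
  by apply: eq_bigr => i _; rewrite mxE nat_indexE.
apply: memv_sumr => l _ /=; rewrite /u; case: ifP => [_|/negbT]; first exact: memv_line.
rewrite negb_forall => /existsP[i]; rewrite negbK => /eqP ri0.
suff -> : pure_tensor (row l) = 0 by apply: mem0v.
by apply/rowP => x; rewrite !mxE (bigD1 i) //= ri0 mxE mul0r.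
Qed.

Definition parameter : finType := ('I_s * {i : 'I_k & 'I_(n i).+1})%type.
Local Notation M := #|parameter|.

Definition parameter_rank (l : 'I_s) (i : 'I_k) (b : 'I_(n i).+1) : 'I_M :=
  enum_rank ((l, Tagged (fun i : 'I_k => 'I_(n i).+1) b) : parameter).
Local Notation rk := parameter_rank.

Definition segre_param (x : 'I_N) : {mpoly F[M]} :=
  \sum_(l < s) \prod_(i < k) 'X_(rk l ((enum_val x : multi_index n) i)).

Definition param_point v (t : 'I_M) : F :=
  let: (l, p) := enum_val t in v l (tag p) (tagged p).

Lemma param_point_rk v l i b : param_point v (@rk l i b) = v l i b.
Proof. by rewrite /param_point /rk enum_rankK. Qed.

Lemma param_pointE v x :
  (segre_param x).@[param_point v] = tensor_sum s k v (nat_index x).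
Proof.
rewrite [LHS]raddf_sum; apply: eq_bigr => l _.
rewrite /= rmorph_prod; apply: eq_bigr => i _.
by rewrite /= mevalXU param_point_rk nat_indexE.
Qed.

Lemma param_point_surj (t : 'I_M -> F) : exists v, t =1 param_point v.
Proof.
exists (fun l i b => if (insub l : option 'I_s) is Some l' then
  if (insub i : option 'I_k) is Some i' then t (@rk l' i' (inord b)) else 0
  else 0) => a.
rewrite /param_point; case E: (enum_val a) => [l [i b]] /=.
by rewrite !valK inord_val /rk -E enum_valK.
Qed.

Definition secant_jacobian v : 'M[F]_(M, N) :=
  \matrix_(t, x) (mderiv t (segre_param x)).@[param_point v].

Lemma secant_jacobianE v y x :
  \sum_t param_point y t * (mderiv t (segre_param x)).@[param_point v] =
  tangent s k v y (nat_index x).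
Proof.
have E t : (mderiv t (segre_param x)).@[param_point v] =
    \sum_(l < s) \sum_(i < k) (rk l ((enum_val x : multi_index n) i) == t)%:R *
      \prod_(i' < k | i' != i) v l i' (nat_index x i').
  rewrite /segre_param [mderiv _ _]raddf_sum [LHS]raddf_sum; apply: eq_bigr => l _ /=.
  rewrite mderiv_prod ?index_enum_uniq // [LHS]raddf_sum; apply: eq_bigr => i _ /=.
  rewrite mevalM mderivXU; congr (_ * _).
    by case: (_ == _); rewrite ?meval1 ?meval0.
  rewrite rmorph_prod; apply: eq_bigr => i' _.
  by rewrite /= mevalXU param_point_rk nat_indexE.
under eq_bigr => t _ do rewrite E mulr_sumr.
rewrite exchange_big; apply: eq_bigr => l _ /=.
under eq_bigr => t _ do rewrite mulr_sumr.
rewrite exchange_big; apply: eq_bigr => i _ /=.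
rewrite (bigD1 (rk l ((enum_val x : multi_index n) i))) //= [X in _ + X]big1 => [|t /negbTE tr].
  by rewrite eqxx mul1r addr0 param_point_rk nat_indexE.
by rewrite eq_sym tr mul0r mulr0.
Qed.

Lemma secant_chain v : (exists x, tensor_sum s k v (nat_index x) != 0) ->
  has_chain Z (\rank (secant_jacobian v)).-1.
Proof.
move=> [x vx]; apply: (jacobian_chain charF0 k_gt0) => [{vx}x c t|d f fd fZ t||{vx}x].
- rewrite ![(segre_param x).@[_]]raddf_sum mulr_sumr; apply: eq_bigr => l _ /=.
  have -> : c ^+ k = \prod_(i < k) c by rewrite prodr_const card_ord.
  rewrite !rmorph_prod /= -big_split.
  by apply: eq_bigr => i _; rewrite /= !mevalXU.
- have [v' tv'] := param_point_surj t; rewrite -[RHS](secant_vanish fd fZ v').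
  by apply: meval_eq => y; rewrite (meval_eq _ tv') param_pointE.
- by exists x; rewrite param_pointE.
- by rewrite secant_jacobianE tangent_self param_pointE.
Qed.

Lemma card_params : M = (s * (\sum_(i < k) n i + k))%N.
Proof.
rewrite card_prod card_ord card_tagged sumnE big_map big_enum /=.
congr (_ * _)%N; under eq_bigr do rewrite card_ord -addn1.
by rewrite big_split /= sum_nat_const card_ord muln1.
Qed.

(** The kernel of the differential meets the space where the s (k - 1) anchored
    coordinates vanish in zero, so it has dimension at most s (k - 1). *)
Lemma secant_jacobian_rank_ge v (anchor : nat -> nat -> nat) (i0 : 'I_k) :
    (forall (l : 'I_s) (i : 'I_k), (anchor l i <= n i)%N) ->
    tangent_injective s n v anchor i0 ->
  (s * (\sum_(i < k) n i).+1 <= \rank (secant_jacobian v))%N.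
Proof.
move=> anchor_n vinj; pose J := secant_jacobian v.
(* E is the matrix of the projection to the s (k - 1) anchored coordinates *)
pose G : finType := ('I_s * {i : 'I_k | i != i0})%type.
pose E : 'M[F]_(M, #|G|) := \matrix_(t, g)
  (t == @rk (enum_val g : G).1 (val (enum_val g : G).2)
          (inord (anchor (enum_val g : G).1 (val (enum_val g : G).2))))%:R.
have freeJE : row_free (row_mx J E).
  apply: inj_row_free => z; rewrite mul_mx_row => /(congr1 (fun A => (lsubmx A, rsubmx A))).
  rewrite row_mxKl row_mxKr linear0 linear0 => -[zJ zE].
  have [y zy] := param_point_surj (fun t => z 0 t).
  suff y0 (l : 'I_s) (i : 'I_k) b : (b <= n i)%N -> y l i b = 0.
    apply/rowP => t; rewrite zy mxE /param_point; case: (enum_val t) => l [i b] /=.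
    by rewrite y0 // -ltnS.
  apply: vinj => [j jn|l' i' ii'].
    have [x xj] := nat_index_surj jn; rewrite -(eq_tangent _ _ xj) -secant_jacobianE.
    have := congr1 (fun w : 'rV_N => w 0 x) zJ; rewrite !mxE => zJx; rewrite -[RHS]zJx.
    by apply: eq_bigr => t _; rewrite zy !mxE.
  have := congr1 (fun w : 'rV_#|G| => w 0 (enum_rank ((l', exist _ i' ii') : G))) zE.
  rewrite !mxE (bigD1 (@rk l' i' (inord (anchor l' i')))) //= big1 => [|t tr].
    rewrite mxE enum_rankK /= eqxx mulr1 addr0 zy param_point_rk inordK //.
    by rewrite ltnS.
  by rewrite mxE enum_rankK /= (negbTE tr) mulr0.
have : (M <= \rank J + #|G|)%N.
  rewrite -[X in (X <= _)%N](eqP freeJE) -mxrank_tr tr_row_mx -addsmxE.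
  apply: leq_trans (mxrank_adds_leqif _ _).1 _.
  by rewrite !mxrank_tr leq_add2l rank_leq_col.
have -> : #|G| = (s * k.-1)%N by rewrite card_prod card_ord card_sig cardC1 card_ord.
rewrite -/J; move: (\rank J) => r.
rewrite card_params (addnC r) -leq_subLR -mulnBr.
by rewrite -[X in (_ + X - _)%N](prednK k_gt0) addnS subSn ?leq_addl // addnK.
Qed.

Lemma secant_jacobian_full v :
  tangent_surjective s n v -> \rank (secant_jacobian v) = N.
Proof.
move=> vfull; suff : row_full (secant_jacobian v) by move/eqP.
have [y yP] : exists y : 'I_N -> nat -> nat -> nat -> F, forall x x',
    tangent s k v (y x) (nat_index x') = (x == x')%:R.
  apply: (fin_all_exists (P := fun x y => forall x',
    tangent s k v y (nat_index x') = (x == x')%:R)) => x.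
  have [y yP] := vfull _ (nat_index_le x).
  exists y => x'; rewrite yP; last exact: nat_index_le.
  congr (nat_of_bool _)%:R; apply/forallP/eqP => [H|-> //].
  by apply: nat_index_inj => i; rewrite (eqP (H i)).
apply/row_fullP; exists (\matrix_(x, t) param_point (y x) t).
apply/matrixP => x x'; rewrite !mxE -yP -secant_jacobianE.
by apply: eq_bigr => t _; rewrite !mxE.
Qed.

End SecantSegre.

(** * Upper bounds for the dimension of secant varieties *)

Lemma meval_mmap_horner (F : fieldType) N (f : {mpoly F[N]}) (z : 'I_N -> {poly F}) c :
  (mmap polyC z f).[c] = f.@[fun i => (z i).[c]].
Proof.
rewrite /mmap horner_sum mevalE; apply: eq_bigr => m _.
rewrite hornerM hornerC horner_prod; congr (_ * _).
by apply: eq_bigr => i _; rewrite horner_exp.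
Qed.

(** A closed condition satisfied at all but finitely many points of a curve holds
    along the whole curve; this is how density is used below. *)
Lemma meval_curve (F : fieldType) (charF0 : [pchar F] =i pred0) N
    (f : {mpoly F[N]}) (z : 'I_N -> {poly F}) (q : {poly F}) : q != 0 ->
    (forall c, q.[c] != 0 -> f.@[fun i => (z i).[c]] = 0) ->
  forall c, f.@[fun i => (z i).[c]] = 0.
Proof.
move=> q0 H c; pose g := mmap polyC z f.
have : g * q == 0.
  apply: contraT => /(poly_nonroot charF0)[x]; rewrite hornerM meval_mmap_horner.
  by have [->|/H ->] := eqVneq q.[x] 0; rewrite ?mulr0 ?mul0r eqxx.
rewrite mulf_eq0 (negbTE q0) orbF => /eqP g0.
by rewrite -meval_mmap_horner -/g g0 horner0.
Qed.

Section SecantBounds.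
Variable F : fieldType.
Hypothesis charF0 : [pchar F]%R =i pred0.
Variables (s k : nat) (n : 'I_k -> nat).
Hypothesis k_gt0 : (0 < k)%N.
Implicit Types (v : nat -> nat -> nat -> F).

Local Notation N := #|{: multi_index n}|.
Local Notation Z := (secant_variety s (segre F n)).

Lemma secant_bound m (psi : 'I_N -> {mpoly F[m]}) e :
    (forall f, f \msub psi = 0 ->
      forall v, f.@[fun x => tensor_sum s k v (nat_index x)] = 0) ->
  has_chain Z e -> (e < m)%N.
Proof.
move=> H; apply: (chain_bound (psi := psi)) => f /H fv.
exact: vanish_on_secant.
Qed.

Lemma secant_bound_ambient e : has_chain Z e -> (e < N)%N.
Proof.
apply: (secant_bound (psi := fun x => 'X_x)) => f f0 v.
suff -> : f = 0 by rewrite meval0.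
by rewrite -[LHS]comp_mpoly_id -[RHS]f0.
Qed.

(** A pure tensor whose vectors have nonzero coordinates of index 0 is a scalar
    times a pure tensor for which these coordinates are 1. The other sums are
    reached along curves that add a multiple of the first basis vector to all the
    vectors. *)
Lemma secant_bound_params e :
  has_chain Z e -> (e < s * (\sum_(i < k) n i).+1)%N.
Proof.
pose T : finType := ('I_s * option {i : 'I_k & 'I_(n i)})%type.
have <- : #|T| = (s * (\sum_(i < k) n i).+1)%N.
  rewrite card_prod card_ord card_option card_tagged sumnE big_map big_enum /=.
  by under eq_bigr do rewrite card_ord.
pose X (t : T) : {mpoly F[#|T|]} := 'X_(enum_rank t).
pose psi (x : 'I_N) := \sum_(l < s) X (l, None) * \prod_(i < k)
  (if unlift ord0 ((enum_val x : multi_index n) i) is Some b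
   then X (l, Some (Tagged (fun i => 'I_(n i)) b)) else 1).
apply: (secant_bound (psi := psi)) => f fpsi v.
pose w l i b : {poly F} := (v l i b)%:P + (b == 0%N)%:R *: 'X.
pose z (x : 'I_N) := \sum_(l < s) \prod_(i < k) w l i (nat_index x i).
have wc c l i b : (w l i b).[c] = v l i b + (b == 0%N)%:R * c.
  by rewrite hornerD hornerC hornerZ hornerX.
have zc c x : (z x).[c] = \sum_(l < s) \prod_(i < k) (w l i (nat_index x i)).[c].
  by rewrite horner_sum; apply: eq_bigr => l _; rewrite horner_prod.
have z0 x : tensor_sum s k v (nat_index x) = (z x).[0].
  rewrite zc; apply: eq_bigr => l _; apply: eq_bigr => i _.
  by rewrite wc mulr0 addr0.
rewrite (meval_eq _ z0).
apply: (meval_curve charF0 (q := \prod_(l < s) \prod_(i < k) w l i 0%N)) => [|c].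
  apply/prodf_neq0 => l _; apply/prodf_neq0 => i _.
  by rewrite -size_poly_gt0 /w scale1r addrC size_XaddC.
rewrite horner_prod => /prodf_neq0 qc.
have {}qc (l : 'I_s) (i : 'I_k) : (w l i 0%N).[c] != 0.
  by have := qc l isT; rewrite horner_prod => /prodf_neq0/(_ i isT).
pose t (a : 'I_#|T|) : F := match enum_val a with
  | (l, None) => \prod_(i < k) (w l i 0%N).[c]
  | (l, Some p) => (w l (tag p) (tagged p).+1).[c] / (w l (tag p) 0%N).[c] end.
have tX a : (X a).@[t] = match a with
  | (l, None) => \prod_(i < k) (w l i 0%N).[c]
  | (l, Some p) => (w l (tag p) (tagged p).+1).[c] / (w l (tag p) 0%N).[c] end.
  by rewrite mevalXU /t enum_rankK.
transitivity (f \msub psi).@[t]; last by rewrite fpsi meval0.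
rewrite msub_meval; apply: meval_eq => x; rewrite zc [RHS]raddf_sum.
apply: eq_bigr => l _; rewrite /= mevalM tX rmorph_prod -big_split /=.
apply: eq_bigr => i _; rewrite nat_indexE.
case: unliftP => [b|] -> /=; last by rewrite meval1 mulr1.
by rewrite tX /= mulrC divfK.
Qed.

Lemma secant_bound_hypersurface (q : {mpoly F[N]}) e : q != 0 ->
    (forall v, q.@[fun x => tensor_sum s k v (nat_index x)] = 0) ->
  has_chain Z e -> (e.+1 < N)%N.
Proof.
move=> q0 qv; apply: (chain_bound_hypersurface q0).
exact: vanish_on_secant.
Qed.

End SecantBounds.

Section ThreeFactors.
Variable F : fieldType.
Hypothesis charF0 : [pchar F]%R =i pred0.

Local Notation o0 := (@Ordinal 3 0 isT).
Local Notation o1 := (@Ordinal 3 1 isT).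
Local Notation o2 := (@Ordinal 3 2 isT).

Lemma big_ord3 (R : Type) (idx : R) (op : Monoid.law idx) (f : 'I_3 -> R) :
  \big[op/idx]_(i < 3) f i = op (op (f o0) (f o1)) (f o2).
Proof.
rewrite !big_ord_recr big_ord0 Monoid.mul1m /=.
by congr (op (op (f _) (f _)) (f _)); apply: val_inj.
Qed.

(** Grouping the first two factors, a sum of s pure tensors becomes a matrix of rank
    at most s. If its first s columns are independent it is B (I | C), where B has
    s columns; the other sums are reached along curves that add a multiple of the
    identity to the first s coordinates of the vectors of the last factor. *)
Lemma secant_bound_flattening s (n : 'I_3 -> nat) e : (s <= (n o2).+1)%N ->
    has_chain (secant_variety s (segre F n)) e ->
  (e < s * ((n o0).+1 * (n o1).+1) + s * ((n o2).+1 - s))%N.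
Proof.
move=> sn.
pose T : finType :=
  (('I_(n o0).+1 * 'I_(n o1).+1 * 'I_s) + ('I_s * 'I_((n o2).+1 - s)))%type.
have <- : #|T| = (s * ((n o0).+1 * (n o1).+1) + s * ((n o2).+1 - s))%N.
  by rewrite card_sum !card_prod !card_ord mulnC.
pose X (t : T) : {mpoly F[#|T|]} := 'X_(enum_rank t).
pose ix (x : 'I_#|{: multi_index n}|) i : 'I_(n i).+1 :=
  (enum_val x : multi_index n) i.
pose C (q : 'I_s) (b : nat) : {mpoly F[#|T|]} :=
  if (b < s)%N then (b == q)%:R
  else if insub (b - s)%N is Some b' then X (inr (q, b')) else 0.
pose psi x := \sum_(q < s) X (inl (ix x o0, ix x o1, q)) * C q (ix x o2).
apply: (secant_bound charF0 _ (psi := psi)) => // f fpsi v.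
pose A : 'M[F]_s := \matrix_(l, q) v l 2%N q.
pose w (l b : nat) : {poly F} := (v l 2%N b)%:P + (b == l)%:R *: 'X.
have wc c l b : (w l b).[c] = v l 2%N b + (b == l)%:R * c.
  by rewrite hornerD hornerC hornerZ hornerX.
pose z x : {poly F} :=
  \sum_(l < s) (v l 0%N (ix x o0) * v l 1%N (ix x o1)) *: w l (ix x o2).
have zc c x : (z x).[c] =
    \sum_(l < s) v l 0%N (ix x o0) * v l 1%N (ix x o1) * (w l (ix x o2)).[c].
  by rewrite horner_sum; apply: eq_bigr => l _; rewrite hornerZ.
have z0 x : tensor_sum s 3 v (nat_index x) = (z x).[0].
  rewrite zc; apply: eq_bigr => l _; rewrite big_ord3 !(nat_indexE x).
  by rewrite wc mulr0 addr0.
rewrite (meval_eq _ z0).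
apply: (meval_curve charF0 (q := char_poly (- A))) => [|c].
  exact/monic_neq0/char_poly_monic.
pose W : 'M[F]_s := \matrix_(l, q) (w l q).[c].
have -> : (char_poly (- A)).[c] = \det W.
  rewrite -[LHS]/(horner_eval c _) -det_map_mx; congr (\det _).
  apply/matrixP => l q.
  rewrite !mxE wc [LHS]hornerD hornerN hornerMn hornerX hornerC -val_eqE /=.
  rewrite (eq_sym (l : nat)).
  by rewrite opprK addrC mulr_natl.
move=> detW; have uW : W \in unitmx by rewrite unitmxE unitfE.
pose W1 : 'M[F]_(s, (n o2).+1 - s) := \matrix_(l, b) (w l (s + b)%N).[c].
pose D := invmx W *m W1.
have WD : W *m D = W1 by rewrite mulKVmx.
pose t (a : 'I_#|T|) : F := match enum_val a with
  | inl (p, p', q) => \sum_(l < s) v l 0%N p * v l 1%N p' * W l q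
  | inr (q, b) => D q b end.
transitivity (f \msub psi).@[t]; last by rewrite fpsi meval0.
rewrite msub_meval; apply: meval_eq => x; rewrite zc [RHS]raddf_sum /=.
have E q : (X (inl (ix x o0, ix x o1, q)) * C q (ix x o2)).@[t] =
    \sum_(l < s) v l 0%N (ix x o0) * v l 1%N (ix x o1) *
                 (W l q * (C q (ix x o2)).@[t]).
  rewrite mevalM [X in X * _ = _]mevalXU [X in X * _ = _]/t enum_rankK mulr_suml.
  by apply: eq_bigr => l _; rewrite !mulrA.
under [RHS]eq_bigr => q _ do rewrite E.
rewrite exchange_big; apply: eq_bigr => l _ /=; rewrite -mulr_sumr; congr (_ * _).
rewrite /C; case: (ltnP (ix x o2) s) => bs.
  rewrite (bigD1 (Ordinal bs)) //= big1 => [|q /negbTE qb].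
    by rewrite eqxx meval1 mulr1 addr0 mxE.
  by rewrite -val_eqE /= eq_sym in qb; rewrite qb meval0 mulr0.
have bn : (ix x o2 - s < (n o2).+1 - s)%N by rewrite ltn_sub2r // (leq_ltn_trans bs).
rewrite insubT; have := congr1 (fun W' : 'M_(s, _) => W' l (Ordinal bn)) WD.
rewrite !mxE /= subnKC // => <-.
by apply: eq_bigr => q _; rewrite mevalXU /t enum_rankK.
Qed.

End ThreeFactors.

(** * Strassen's equation for 3 x 3 x 3 tensors *)

Section Strassen.
Variable F : fieldType.
Hypothesis charF0 : [pchar F]%R =i pred0.

Definition levi_civita (R : nzRingType) (a b r : nat) : R :=
  match a, b, r with
  | 0, 1, 2 | 1, 2, 0 | 2, 0, 1 => 1%R
  | 0, 2, 1 | 2, 1, 0 | 1, 0, 2 => (-1)%R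
  | _, _, _ => 0%R
  end%N.

Local Notation P33 := ('I_3 * 'I_3)%type.

Definition fst3 (i : 'I_#|{: P33}|) : 'I_3 := (enum_val i).1.
Definition snd3 (i : 'I_#|{: P33}|) : 'I_3 := (enum_val i).2.

(** The Koszul flattening of a tensor of slices X_0, X_1, X_2: the 3 x 3 skew matrix
    of blocks X_r given by the cross product. On a pure tensor it is the
    Kronecker product of a cross product matrix and a rank one matrix. *)
Definition koszul (R : comNzRingType) (X : nat -> nat -> nat -> R) :
    'M[R]_(#|{: P33}|) :=
  \matrix_(i, j) \sum_(r < 3) levi_civita R (fst3 i) (fst3 j) r *
                    X (snd3 i) (snd3 j) r.

(** The cross product matrix kills c itself. *)
Lemma koszul_skew_rank (c : nat -> F) :
  (\rank (\matrix_(a < 3, b < 3)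
     (\sum_(r < 3) levi_civita F a b r * c r)%R) <= 2)%N.
Proof.
set S := (X in \rank X); rewrite -ltnS ltn_neqAle rank_leq_row andbT.
apply/negP => /eqP rS; have /row_free_inj freeS : row_free S by rewrite /row_free rS.
pose u : 'rV[F]_3 := \row_a c a.
have uS : u *m S = 0.
  apply/rowP => b; rewrite !mxE !big_ord_recr !big_ord0 /= !mxE !big_ord_recr !big_ord0 /=.
  by case: b => [[|[|[|//]]] ?] /=; ring.
have u0 : u = 0 by apply: freeS; rewrite uS mul0mx.
suff S0 : S = 0 by rewrite S0 mxrank0 in rS.
apply/matrixP => a b; rewrite !mxE big1 // => r _.
by have /rowP/(_ r) := u0; rewrite !mxE => ->; rewrite mulr0.
Qed.

Lemma koszul_pure_rank (a b c : nat -> F) :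
  (\rank (koszul (fun p q r => (a p * b q * c r)%R)) <= 2)%N.
Proof.
set S := \matrix_(a < 3, b < 3) \sum_(r < 3) levi_civita F a b r * c r.
pose U : 'M[F]_(_, 3) := \matrix_(i < #|{: P33}|, e < 3)
  (((fst3 i) == e)%:R * a (snd3 i)).
pose V : 'M[F]_(3, _) := \matrix_(e < 3, j < #|{: P33}|)
  (((fst3 j) == e)%:R * b (snd3 j)).
have -> : koszul (fun p q r => a p * b q * c r) = U *m S *m V.
  apply/matrixP => i j; rewrite !mxE [RHS](bigD1 (fst3 j)) //=.
  rewrite [X in _ = _ + X]big1 => [|e /negbTE ne].
    rewrite !mxE [in RHS](bigD1 (fst3 i)) //=.
    rewrite [X in _ = (_ + X) * _ + _]big1 => [|e /negbTE ne].
      rewrite !mxE !eqxx !mul1r !addr0 mulr_sumr mulr_suml; apply: eq_bigr => r _.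
      by ring.
    by rewrite !mxE eq_sym ne !mul0r.
  by rewrite !mxE eq_sym ne mul0r mulr0.
apply: leq_trans (mxrankM_maxl _ _) _; apply: leq_trans (mxrankM_maxr _ _) _.
exact: koszul_skew_rank.
Qed.

(** Four summands of rank at most 2 give rank at most 8, and the matrix has size 9. *)
Lemma koszul_det_tensor_sum (v : nat -> nat -> nat -> F) :
  \det (koszul (fun p q r =>
    \sum_(l < 4) v l 0%N p * v l 1%N q * v l 2%N r)) = 0.
Proof.
set K := koszul _; apply/eqP; apply: contraTT isT => detK.
have rK : \rank K = 9%N.
  have : row_free K by rewrite row_free_unit unitmxE unitfE.
  by move/eqP => ->; rewrite card_prod card_ord.
have KE : K = \sum_(l < 4) koszul (fun p q r => v l 0%N p * v l 1%N q * v l 2%N r).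
  apply/matrixP => i j; rewrite summxE mxE; under [RHS]eq_bigr => l _ do rewrite mxE.
  rewrite exchange_big; apply: eq_bigr => r _ /=.
  by rewrite mulr_sumr.
suff : (\rank K <= 8)%N by rewrite rK.
rewrite KE; have -> : 8%N = (\sum_(l < 4) 2)%N by rewrite sum_nat_const card_ord.
elim/big_ind2: _ => [|m1 x m2 y m1x m2y|l _]; first by rewrite mxrank0.
  by apply: leq_trans (mxrank_add _ _) _; rewrite leq_add.
exact: koszul_pure_rank.
Qed.

(** The determinant of the Koszul flattening with X_0 = 1 is, up to sign, that of
    the commutator of X_1 and X_2. Here X_1 = diag (0, 1, 2) and X_2 is a cyclic
    permutation matrix, and their commutator is an invertible monomial matrix. *)
Definition strassen_point (p q r : nat) : F :=
  match r with
  | 0 => (p == q)%:R%R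
  | 1 => ((p == q)%:R * p%:R)%R
  | _ => ((q == p.+1) || (p == 2) && (q == 0))%:R%R
  end%N.

Lemma koszul_det_neq0 : \det (koszul strassen_point) != 0.
Proof.
rewrite -unitfE -unitmxE -row_free_unit; apply: inj_row_free => y yK.
pose z a p := y 0 (enum_rank ((inord a : 'I_3), (inord p : 'I_3))).
have E (b q : 'I_3) : \sum_(a < 3) \sum_(p < 3) z a p *
    \sum_(r < 3) levi_civita F a b r * strassen_point p q r = 0.
  transitivity ((y *m koszul strassen_point) 0 (enum_rank (b, q))); last by rewrite yK mxE.
  rewrite mxE pair_bigA [RHS](reindex_onto enum_rank enum_val) /=; last first.
    by move=> *; rewrite enum_valK.
  apply: eq_big => [[a p]|[a p] _] /=; first by rewrite enum_rankK eqxx.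
  by rewrite !mxE /fst3 /snd3 !enum_rankK /z !inord_val.
have H b q : (b < 3)%N -> (q < 3)%N -> \sum_(a < 3) \sum_(p < 3) z a p *
    \sum_(r < 3) levi_civita F a b r * strassen_point p q r = 0.
  by move=> b3 q3; apply: (E (Ordinal b3) (Ordinal q3)).
suff z0 a p : (a < 3)%N -> (p < 3)%N -> z a p = 0.
  apply/rowP => i; rewrite mxE -[i]enum_valK; case: (enum_val i) => a p.
  by have := z0 a p (ltn_ord a) (ltn_ord p); rewrite /z !inord_val.
have {E} H' : forall b q, (b < 3)%N -> (q < 3)%N ->
    0 = \sum_(a < 3) \sum_(p < 3) z a p *
        \sum_(r < 3) levi_civita F a b r * strassen_point p q r.
  by move=> *; rewrite H.
have := (H' 0 0 isT isT, H' 0 1 isT isT, H' 0 2 isT isT,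
         H' 1 0 isT isT, H' 1 1 isT isT, H' 1 2 isT isT,
         H' 2 0 isT isT, H' 2 1 isT isT, H' 2 2 isT isT)%N.
rewrite !big_ord_recr !big_ord0 /=.
rewrite !(mul0r, mul1r, mulN1r, add0r, addr0, subr0, oppr0, mulr0, mulr1, mulrN).
move=> [[[[[[[[e12 e1] e2] e3] e4] e5] e10] e7] e8].
have z12 : z 1%N 2%N = 0 by rewrite -[LHS]opprK -e12 oppr0.
have z02 : z 0%N 2%N = 0.
  move/esym/eqP: e8; rewrite z12 addr0 oppr_eq0 mulf_eq0 => /orP[/eqP //|].
  by rewrite ((pcharf0P F).1 charF0).
have z21 : z 2%N 1%N = 0 by move: e1; rewrite -e10 oppr0 add0r.
have z20 : z 2%N 0%N = 0 by apply/esym/eqP; rewrite -subr_eq0 -z02 -e3 z02.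
have z00 : z 0%N 0%N = 0 by move: e4; rewrite z21 subr0.
have z22 : z 2%N 2%N = 0.
  transitivity ((- z 1%N 1%N + z 2%N 2%N * 2) + (- z 0%N 1%N + z 1%N 1%N)
                + (z 0%N 1%N - z 2%N 2%N)); first by ring.
  by rewrite -e2 -e7 -e5 !addr0.
have z01 : z 0%N 1%N = 0 by move: e5; rewrite z22 subr0.
have z11 : z 1%N 1%N = 0 by move: e7; rewrite z01 oppr0 add0r.
by case: a => [|[|[|//]]] _; case: p => [|[|[|//]]] _.
Qed.

Lemma strassen_bound (n : 'I_3 -> nat) e : (forall i, n i = 2%N) ->
  has_chain (secant_variety 4 (segre F n)) e -> (e < 26)%N.
Proof.
move=> n2.
pose ix (p q r : nat) : 'I_#|{: multi_index n}| :=
  enum_rank ([ffun i => inord (nth 0%N [:: p; q; r] i) : 'I_(n i).+1]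
    : multi_index n).
pose K := koszul (fun p q r => 'X_(ix p q r) : {mpoly F[#|{: multi_index n}|]}).
have KE w : (\det K).@[w] = \det (koszul (fun p q r => w (ix p q r))).
  rewrite -det_map_mx; congr (\det _); apply/matrixP => i j; rewrite !mxE.
  rewrite [LHS]raddf_sum; apply: eq_bigr => r _; rewrite /= mevalM mevalXU.
  congr (_ * _).
  rewrite /levi_civita; move: (nat_of_ord _) (nat_of_ord _) (nat_of_ord r).
  by do 3![case=> [|[|[|?]]]]; rewrite ?meval0 ?meval1 ?mevalN ?meval1.
have N27 : #|{: multi_index n}| = 27%N.
  rewrite card_multi_index; under eq_bigr do rewrite n2.
  by rewrite prod_nat_const card_ord.
have ixE p q r i : (i < 3)%N -> (p < 3)%N -> (q < 3)%N -> (r < 3)%N ->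
    nat_index (ix p q r) i = nth 0%N [:: p; q; r] i.
  move=> i3 p3 q3 r3; rewrite (nat_indexE _ (Ordinal i3)) enum_rankK ffunE inordK // n2.
  by case: i i3 => [|[|[|//]]].
have koszul_eq (X Y : nat -> nat -> nat -> F) :
    (forall p q r, (p < 3)%N -> (q < 3)%N -> (r < 3)%N -> X p q r = Y p q r) ->
    koszul X = koszul Y.
  move=> XY; apply/matrixP => i j; rewrite !mxE.
  by apply: eq_bigr => r _; rewrite XY.
move=> chain_e; rewrite -ltnS -[X in (_ < X)%N]N27.
apply: (secant_bound_hypersurface charF0 _ (q := \det K) _ _ chain_e) => //.
- apply/eqP => /(congr1 (meval (fun x =>
    strassen_point (nat_index x 0) (nat_index x 1) (nat_index x 2)))).
  rewrite meval0 KE => /eqP; apply/negP.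
  rewrite (koszul_eq _ strassen_point) ?koszul_det_neq0 //.
  by move=> p q r p3 q3 r3; rewrite !ixE.
- move=> v; rewrite KE -[RHS](koszul_det_tensor_sum v); congr (\det _); apply: koszul_eq.
  move=> p q r p3 q3 r3; apply: eq_bigr => l _.
  by rewrite !big_ord_recr big_ord0 /= mul1r !ixE.
Qed.

End Strassen.

(** * Coordinate points indexed by codes *)

Section Codes.
Variables (F : fieldType) (s k : nat) (n : 'I_k -> nat) (w : nat -> nat -> nat).

Definition codeword_point (l i b : nat) : F := (b == w l i)%:R.
Local Notation v := codeword_point.

Lemma prod_codeword_eq (P : pred 'I_k) l (j : nat -> nat) :
  (forall i : 'I_k, P i -> j i = w l i) -> \prod_(i < k | P i) v l i (j i) = 1.
Proof. by move=> H; apply: big1 => i Pi; rewrite /v H ?eqxx. Qed.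

Lemma prod_codeword_neq (P : pred 'I_k) l (j : nat -> nat) (i : 'I_k) :
  P i -> j i != w l i -> \prod_(i < k | P i) v l i (j i) = 0.
Proof. by move=> Pi ji; rewrite (bigD1 i) //= /v (negbTE ji) mul0r. Qed.

(** The tangent space at a coordinate point is spanned by the basis tensors whose
    multi-indices differ from the word in at most one place. At minimum distance 3
    these Hamming balls are disjoint, so each coordinate of the differential
    involves a single point. *)
Lemma separated_code_injective (i0 : 'I_k) :
    (forall (l : 'I_s) (i : 'I_k), (w l i <= n i)%N) ->
    (forall l l' : 'I_s, l != l' ->
       (2 < #|[set i : 'I_k | w l i != w l' i]|)%N) ->
  tangent_injective s n v w i0.
Proof.
move=> wn w_sep y yt anch l i b bn.
(* a multi-index j in the ball around the word w l isolates y l i b *)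
pose j (a : nat) := if a == i then b else w l a.
have jn (a : 'I_k) : (j a <= n a)%N.
  by rewrite /j; case: eqP => [/val_inj ->|].
have : tangent s k v y j = 0 by apply: yt.
rewrite /tangent (bigD1 l) //= [X in _ + X]big1 ?addr0 => [|l' l'l]; last first.
  apply: big1 => i' _.
  have : (0 < #|[set a : 'I_k | w l a != w l' a] :\: [set i; i']|)%N.
    have := w_sep l l'; rewrite eq_sym l'l => /(_ isT) w3.
    rewrite cardsD subn_gt0; apply: leq_ltn_trans w3.
    by apply: leq_trans (subset_leq_card (subsetIr _ _)) _; rewrite cards2; case: (_ != _).
  rewrite card_gt0 => /set0Pn[a]; rewrite !inE negb_or => /andP[/andP[ai ai'] wa].
  by rewrite (@prod_codeword_neq _ _ _ a) ?mulr0 // /j val_eqE (negbTE ai).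
have [bw|bw] := eqVneq b (w l i).
  have jE (a : nat) : j a = w l a by rewrite /j; case: eqP => // ->.
  rewrite (bigD1 i0) //= [X in _ + X]big1 ?addr0 => [|i' i'i0]; last first.
    by rewrite jE anch // mul0r.
  rewrite prod_codeword_eq // mulr1 jE => yi0.
  by rewrite bw; have [->//|ii0] := eqVneq i i0; apply: anch.
rewrite (bigD1 i) //= [X in _ + X]big1 ?addr0 => [|i' i'i]; last first.
  have ii' : i != i' by rewrite eq_sym.
  by rewrite (@prod_codeword_neq _ _ _ i) ?mulr0 // /j eqxx.
rewrite prod_codeword_eq => [|a ai]; first by rewrite mulr1 /j eqxx.
by rewrite /j val_eqE (negbTE ai).
Qed.

Lemma covering_code_surjective :
    (forall j : nat -> nat, (forall i : 'I_k, (j i <= n i)%N) ->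
      exists (l : 'I_s) (i0 : 'I_k), forall i : 'I_k, i != i0 -> j i = w l i) ->
  tangent_surjective s n v.
Proof.
move=> cover j /cover[l [i jw]].
exists (unit_direction F l i (j i)) => j' _; rewrite tangent_unit.
case: (boolP [forall _, _]) => [/forallP H|].
  rewrite (eqP (H i)) eqxx mul1r prod_codeword_eq // => i' i'i.
  by rewrite (eqP (H i')) jw.
rewrite negb_forall => /existsP[i' ji'].
have [ii'|ii'] := eqVneq i' i; first by rewrite -ii' (negbTE ji') mul0r.
by rewrite (@prod_codeword_neq _ _ _ i') ?mulr0 // -jw.
Qed.

End Codes.

(** * Three factors *)

Lemma tangent3E (F : fieldType) s v y (j : nat -> nat) :
  tangent s 3 v y j = \sum_(l < s) (y l 0%N (j 0%N) * (v l 1%N (j 1%N) * v l 2%N (j 2%N))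
    + y l 1%N (j 1%N) * (v l 0%N (j 0%N) * v l 2%N (j 2%N))
    + y l 2%N (j 2%N) * (v l 0%N (j 0%N) * v l 1%N (j 1%N))) :> F.
Proof.
apply: eq_bigr => l _; under eq_bigr => i _ do rewrite big_mkcond.
by rewrite !big_ord_recr !big_ord0 /= ?(mul1r, add0r, mulr1).
Qed.

Lemma lt4_trans a b : (a < 4)%N -> (3 <= b)%N -> (a <= b)%N.
Proof. by move=> a4; apply: leq_trans. Qed.

Section Slices.
Variables (F : fieldType) (n : 'I_3 -> nat).
Local Notation o0 := (@Ordinal 3 0 isT).
Local Notation o1 := (@Ordinal 3 1 isT).
Local Notation o2 := (@Ordinal 3 2 isT).

Definition sliced_point (a b : nat -> nat -> F) (l i x : nat) : F :=
  match i with 0%N => a l x | 1%N => b l x | _ => (x == l)%:R end.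

Definition sliced_anchor (anc : nat -> nat) (l i : nat) : nat :=
  match i with 0%N => anc l | 1%N => 0%N | _ => l end.

(** Take the points a_l (x) b_l (x) e_l. For m < 4, the slice of index m in the last
    factor of the differential involves the tangent directions (z, w) of the first
    two factors at the point m only, besides multiples c l of the other a_l (x) b_l;
    c m is an anchored coordinate. The later slices involve only such multiples. *)
Lemma sliced_injective (a b : nat -> nat -> F) (anc : nat -> nat) : (3 <= n o2)%N ->
    (forall m, (m < 4)%N -> forall z w c : nat -> F, c m = 0 -> z (anc m) = 0 ->
      (forall p q, (p <= n o0)%N -> (q <= n o1)%N ->
         z p * b m q + w q * a m p + \sum_(l < 4) c l * (a l p * b l q) = 0) ->
      [/\ forall p, (p <= n o0)%N -> z p = 0, forall q, (q <= n o1)%N -> w q = 0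
        & forall l, (l < 4)%N -> c l = 0]) ->
    (forall c : nat -> F, (forall p q, (p <= n o0)%N -> (q <= n o1)%N ->
         \sum_(l < 4) c l * (a l p * b l q) = 0) ->
      forall l, (l < 4)%N -> c l = 0) ->
  tangent_injective 4 n (sliced_point a b) (sliced_anchor anc) o1.
Proof.
move=> n3 H1 H2 y yt anch.
have E p q r : (p <= n o0)%N -> (q <= n o1)%N -> (r <= n o2)%N ->
    \sum_(l < 4) (y l 0%N p * b l q + y l 1%N q * a l p) * (r == l)%:R
    + \sum_(l < 4) y l 2%N r * (a l p * b l q) = 0.
  move=> pn qn rn; rewrite -[RHS](yt (nth 0%N [:: p; q; r])); last first.
    by case=> [[|[|[|//]]] i3] /=; rewrite (bool_irrelevance i3 isT).
  rewrite tangent3E -big_split; apply: eq_bigr => l _ /=.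
  by rewrite mulrDl -!mulrA.
have Hm m : (m < 4)%N -> (m <= n o2)%N ->
    [/\ forall p, (p <= n o0)%N -> y m 0%N p = 0,
    forall q, (q <= n o1)%N -> y m 1%N q = 0 & forall l, (l < 4)%N -> y l 2%N m = 0].
  move=> m4 mn; apply: H1 (m4) _ _ (fun l => y l 2%N m) _ _ _.
  - exact: (anch (Ordinal m4) o2).
  - exact: (anch (Ordinal m4) o0).
  - move=> p q pn qn; rewrite -[RHS](E p q m) //.
    rewrite [X in _ = X + _](bigD1 (Ordinal m4)) //= eqxx mulr1.
    rewrite [X in _ = (_ + X) + _]big1 ?addr0 // => l.
    by rewrite -val_eqE eq_sym /= => /negbTE->; rewrite mulr0.
case=> [l l4] [i i3] x /=; have ln := lt4_trans l4 n3.
case: i i3 => [|[|[|//]]] i3; rewrite (bool_irrelevance i3 isT) => xn.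
- by have [H _ _] := Hm l l4 ln; apply: H.
- by have [_ H _] := Hm l l4 ln; apply: H.
case: (ltnP x 4) => x4; first by have [_ _ H] := Hm x x4 xn; apply: H.
apply: (H2 (fun l => y l 2%N x)) => // p q pn qn.
rewrite -[RHS](E p q x) // [X in _ = X + _]big1 ?add0r // => l' _.
by rewrite gtn_eqF ?mulr0 // (leq_trans (ltn_ord l')).
Qed.

(** The vectors (1, l) of F^2, pairwise independent in characteristic zero. *)
Definition pencil (l p : nat) : F := match p with 0%N => 1 | 1%N => l%:R | _ => 0 end.

(** Four points of the plane in general position: the basis vectors e_0, e_1, e_2
    and their sum. *)
Definition frame (l p : nat) : F := if (l < 3)%N then (p == l)%:R else (p < 3)%:R.

Hypothesis charF0 : [pchar F]%R =i pred0.

(** Here b_l = e_l. In the slice m, column q gives multiples of a_m and a_q, which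
    are independent for q <> m. *)
Lemma pencil_injective : (1 <= n o0)%N -> (3 <= n o1)%N -> (3 <= n o2)%N ->
  tangent_injective 4 n (sliced_point pencil (fun l q => (q == l)%:R))
    (sliced_anchor (fun=> 0%N)) o1.
Proof.
move=> n0 n1 n2; apply: sliced_injective => // [m m4 z w c cm z0 E|c E l l4]; last first.
  have := E 0%N l isT (lt4_trans l4 n1).
  rewrite (bigD1 (Ordinal l4)) //= big1 ?addr0 => [|l']; first by rewrite eqxx !mulr1.
  by rewrite -val_eqE eq_sym /= => /negbTE->; rewrite !mulr0.
have {}E p q : (p <= n o0)%N -> (q <= n o1)%N ->
    z p * (q == m)%:R + w q * pencil m p +
    (if (q < 4)%N then c q * pencil q p else 0) = 0.
  move=> pn qn; rewrite -[RHS](E p q) //; congr (_ + _).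
  case: ltnP => q4; last first.
    rewrite big1 // => l _; rewrite gtn_eqF ?mulr0 //; exact: leq_trans q4.
  rewrite (bigD1 (Ordinal q4)) //= big1 ?addr0 => [|l']; first by rewrite eqxx !mulr1.
  by rewrite -val_eqE eq_sym /= => /negbTE->; rewrite !mulr0.
have wm : w m = 0.
  have := E 0%N m isT (lt4_trans m4 n1).
  by rewrite eqxx m4 z0 cm !mul0r mulr1 add0r addr0.
have zp p : (p <= n o0)%N -> z p = 0.
  move=> pn; have := E p m pn (lt4_trans m4 n1).
  by rewrite eqxx m4 wm cm !mul0r mulr1 !addr0.
have cq q : (q < 4)%N -> c q = 0.
  move=> q4; have [->//|qm] := eqVneq q m.
  have := E 0%N q isT (lt4_trans q4 n1); have := E 1%N q n0 (lt4_trans q4 n1).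
  rewrite q4 (negbTE qm) !mulr0 !add0r /= !mulr1 => e1 e0.
  have : c q * (q%:R - m%:R) = 0.
    transitivity ((w q * m%:R + c q * q%:R) - (w q + c q) * m%:R); first by ring.
    by rewrite e0 e1 mul0r subr0.
  move/eqP; rewrite mulf_eq0 => /orP[/eqP//|]; rewrite subr_eq0 => /eqP/(natr_inj charF0) qm'.
  by rewrite qm' eqxx in qm.
split=> // q qn; have := E 0%N q isT qn.
case: ifP => [/cq->|_]; by rewrite ?mul0r z0 mul0r add0r addr0 mulr1.
Qed.

(** In the slice m, modulo the tangent space at a_m (x) a_m, the other three
    a_l (x) a_l become the squares of three pairwise independent vectors of a plane,
    and these squares are independent. *)
Lemma frame_injective : (2 <= n o0)%N -> (2 <= n o1)%N -> (3 <= n o2)%N ->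
  tangent_injective 4 n (sliced_point frame frame)
    (sliced_anchor (fun l => if (l < 3)%N then l else 0%N)) o1.
Proof.
move=> n0 n1 n2.
have le0 p : (p < 3)%N -> (p <= n o0)%N by move=> p3; apply: leq_trans n0.
have le1 p : (p < 3)%N -> (p <= n o1)%N by move=> p3; apply: leq_trans n1.
have sumE (c : nat -> F) p q : \sum_(l < 4) c l * (frame l p * frame l q) =
    (if (p == q) && (p < 3)%N then c p else 0) +
    (if (p < 3)%N && (q < 3)%N then c 3%N else 0).
  rewrite !big_ord_recr big_ord0 /frame /=.
  case: p => [|[|[|p]]]; case: q => [|[|[|q]]] //=;
  rewrite ?(mulr0, mul0r, mulr1, addr0, add0r) //.
  by rewrite andbF.
apply: sliced_injective => // [m m4 z w c cm zm E|c E]; last first.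
  have {}E p q : (p < 3)%N -> (q < 3)%N ->
      (if p == q then c p else 0) + c 3%N = 0.
    by move=> p3 q3; rewrite -[RHS](E p q (le0 p p3) (le1 q q3)) sumE p3 q3 andbT.
  have c3 : c 3%N = 0 by have := E 0%N 1%N isT isT; rewrite /= add0r.
  move=> l l4; have [->//|l3] := eqVneq l 3%N.
  by have := E l l; rewrite eqxx c3 addr0; apply; rewrite ltn_neqAle l3.
have {}E p q : (p <= n o0)%N -> (q <= n o1)%N ->
    z p * frame m q + w q * frame m p + ((if (p == q) && (p < 3)%N then c p else 0) +
     (if (p < 3)%N && (q < 3)%N then c 3%N else 0)) = 0.
  by move=> pn qn; rewrite -[RHS](E p q) // sumE.
have E3 p q : (p < 3)%N -> (q < 3)%N ->
    z p * frame m q + w q * frame m p + ((if p == q then c p else 0) + c 3%N) = 0.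
  by move=> p3 q3; rewrite -[RHS](E p q (le0 p p3) (le1 q q3)) p3 q3 andbT.
have [m3|m3] := ltnP m 3.
  rewrite m3 in zm; have mE q : frame m q = (q == m)%:R by rewrite /frame m3.
  have c3 : c 3%N = 0.
    have [p [q [p3 q3 pm qm pq]]] :
        exists p q, [/\ (p < 3)%N, (q < 3)%N, p != m, q != m & p != q].
      by case: (m) m3 => [|[|[|//]]] _;
        [exists 1%N, 2%N|exists 0%N, 2%N|exists 0%N, 1%N].
    have := E3 p q p3 q3; rewrite !mE (negbTE pm) (negbTE qm) (negbTE pq).
    by rewrite !mulr0 !add0r.
  have cl l : (l < 4)%N -> c l = 0.
    move=> l4; have [->//|l3] := eqVneq l 3%N; have [->//|lm] := eqVneq l m.
    have {}l3 : (l < 3)%N by rewrite ltn_neqAle l3.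
    have := E3 l l l3 l3; rewrite !mE (negbTE lm) eqxx c3.
    by rewrite !mulr0 !add0r addr0.
  have {}E p q : (p <= n o0)%N -> (q <= n o1)%N ->
      z p * (q == m)%:R + w q * (p == m)%:R = 0.
    move=> pn qn; rewrite -[RHS](E p q pn qn) !mE c3 if_same addr0.
    by case: ifP => [/andP[_ p3]|]; rewrite ?cl ?addr0 // (ltn_trans p3).
  have wq q : (q <= n o1)%N -> w q = 0.
    by move=> qn; rewrite -[RHS](E m q (le0 m m3) qn) zm eqxx mul0r add0r mulr1.
  split=> // p pn.
  by rewrite -[RHS](E p m pn (le1 m m3)) (wq _ (le1 m m3)) eqxx mul0r addr0 mulr1.
have {m3} mE : m = 3%N by apply/eqP; rewrite eqn_leq -ltnS m4.
rewrite {}mE in E E3 zm cm *; rewrite /frame /= in E E3 zm *.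
have w1 : w 1%N = 0.
  by have := E3 0%N 1%N isT isT; rewrite /= zm cm mul0r !(add0r, addr0) mulr1.
have w2 : w 2%N = 0.
  by have := E3 0%N 2%N isT isT; rewrite /= zm cm mul0r !(add0r, addr0) mulr1.
have z1 : z 1%N = 0.
  by have := E3 1%N 2%N isT isT; rewrite /= w2 cm mul0r !(add0r, addr0) mulr1.
have z2 : z 2%N = 0.
  by have := E3 2%N 1%N isT isT; rewrite /= w1 cm mul0r !(add0r, addr0) mulr1.
have w0 : w 0%N = 0.
  by have := E3 1%N 0%N isT isT; rewrite /= z1 cm mul0r !(add0r, addr0) mulr1.
have z3 p : (p < 3)%N -> z p = 0 by case: p => [|[|[|//]]].
have w3 p : (p < 3)%N -> w p = 0 by case: p => [|[|[|//]]].
split=> [p pn|q qn|l l4].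
- have [/z3//|p3] := ltnP p 3.
  have := E p 0%N pn (le1 0%N isT); rewrite [(p < 3)%N]ltnNge p3 andbF /=.
  by rewrite w0 mulr1 mul0r !addr0.
- have [/w3//|q3] := ltnP q 3.
  have := E 0%N q (le0 0%N isT) qn; rewrite [(q < 3)%N]ltnNge q3 andbF /=.
  rewrite zm mulr1 mul0r add0r addr0.
  by case: ifP => [/andP[/eqP q0]|]; rewrite ?addr0 // -q0 in q3 *.
have [->//|l3] := eqVneq l 3%N; have {}l3 : (l < 3)%N by rewrite ltn_neqAle l3.
by have := E3 l l l3 l3; rewrite eqxx z3 // w3 // cm !mul0r !add0r addr0.
Qed.

Lemma pencil_span m q p : m != q -> (p <= 1)%N ->
  exists ab : F * F, forall p', (p' <= 1)%N ->
    ab.1 * pencil m p' + ab.2 * pencil q p' = (p' == p)%:R.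
Proof.
move=> mq p1; have d0 : m%:R - q%:R != 0 :> F.
  by rewrite subr_eq0; apply: contra mq => /eqP/(natr_inj charF0) ->.
case: p p1 => [|[|//]] _;
  [exists (- q%:R / (m%:R - q%:R), m%:R / (m%:R - q%:R))
  |exists ((m%:R - q%:R)^-1, - (m%:R - q%:R)^-1)];
  by case=> [|[|//]] _ /=; field.
Qed.

(** The points of pencil_injective projected to F^2 x F^3 x F^4, so that b_3 = 0.
    The basis tensor of index (p, q, m) is a tangent vector at the point q if
    q = m; otherwise e_p is a combination of a_q and a_m, and a_q (x) e_q (x) e_m and
    a_m (x) e_q (x) e_m are tangent at the points q and m. *)
Lemma pencil_surjective : n o0 = 1%N -> n o1 = 2%N -> n o2 = 3%N ->
  tangent_surjective 4 n
    (sliced_point pencil (fun l q => ((q == l) && (q < 3)%N)%:R)).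
Proof.
move=> n0 n1 n2 j jn; set v := sliced_point _ _.
have j0 : (j 0 <= 1)%N by rewrite -n0 (jn o0).
have j1 : (j 1 < 3)%N by rewrite ltnS -n1 (jn o1).
have j2 : (j 2 < 4)%N by rewrite ltnS -n2 (jn o2).
have j14 : (j 1 < 4)%N by apply: leq_trans j1 _.
have eqE (j' : nat -> nat) : [forall i : 'I_3, j' i == j i] =
    [&& j' 0%N == j 0%N, j' 1%N == j 1%N & j' 2%N == j 2%N].
  apply/forallP/and3P => [H|[H0 H1 H2] [[|[|[|//]]] ?] //].
  by split; [apply: (H o0)|apply: (H o1)|apply: (H o2)].
have prod3 (l : nat) (i : 'I_3) (j' : nat -> nat) :
    \prod_(i' < 3 | i' != i) v l i' (j' i') =
    (if i == o0 then 1 else pencil l (j' 0%N)) *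
    (if i == o1 then 1 else ((j' 1%N == l) && (j' 1%N < 3)%N)%:R) *
    (if i == o2 then 1 else (j' 2%N == l)%:R).
  rewrite big_mkcond !big_ord_recr big_ord0 /= mul1r -!val_eqE /=.
  by case: i => [[|[|[|//]]] ?].
have [qm|qm] := eqVneq (j 1%N) (j 2%N).
  exists (unit_direction F (Ordinal j14) o0 (j 0%N)) => j' j'n.
  rewrite tangent_unit prod3 eqE /= mul1r -!natrM !mulnb -qm.
  by case: (eqVneq (j' 1%N)) => [->|]; rewrite ?j1.
have [[a b] abE] := pencil_span qm j0.
exists (fun l i x => a * unit_direction F (Ordinal j14) o2 (j 2%N) l i x +
                     b * unit_direction F (Ordinal j2) o1 (j 1%N) l i x) => j' j'n.
rewrite tangent_linear !tangent_unit !prod3 eqE /= !mulr1.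
rewrite -[in RHS]mulnb natrM -abE /=; last by rewrite -n0 (j'n o0).
case: (eqVneq (j' 1%N)) => [->|]; rewrite ?j1 /= ?(mul0r, mulr0, addr0) //.
by ring.
Qed.

End Slices.

(** * Four factors *)

Lemma tangent4E (F : fieldType) s v y (j : nat -> nat) :
  tangent s 4 v y j = \sum_(l < s) (
      y l 0%N (j 0%N) * (v l 1%N (j 1%N) * v l 2%N (j 2%N) * v l 3%N (j 3%N))
    + y l 1%N (j 1%N) * (v l 0%N (j 0%N) * v l 2%N (j 2%N) * v l 3%N (j 3%N))
    + y l 2%N (j 2%N) * (v l 0%N (j 0%N) * v l 1%N (j 1%N) * v l 3%N (j 3%N))
    + y l 3%N (j 3%N) * (v l 0%N (j 0%N) * v l 1%N (j 1%N) * v l 2%N (j 2%N))) :> F.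
Proof.
apply: eq_bigr => l _; under eq_bigr => i _ do rewrite big_mkcond.
by rewrite !big_ord_recr !big_ord0 /= ?(mul1r, add0r, mulr1).
Qed.

Section FourFactors.
Variable F : fieldType.

Definition even_word (l i : nat) : nat :=
  nth 0%N (nth [::] [:: [:: 0; 0; 0]; [:: 0; 1; 1]; [:: 1; 0; 1]; [:: 1; 1; 0]]%N l) i.

Definition even_word_point (l i b : nat) : F :=
  if i == 3%N then frame F l b else (b == even_word l i)%:R.

(** Any three members of a frame of F^3 are independent. *)
Lemma frame_free3 (c : nat -> F) l0 : (l0 < 4)%N -> c l0 = 0 ->
    (forall t, (t < 3)%N -> \sum_(l < 4) c l * frame F l t = 0) ->
  forall l, (l < 4)%N -> c l = 0.
Proof.
move=> l04 cl0 E.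
have {}E t : (t < 3)%N -> c t + c 3%N = 0.
  move=> t3; rewrite -[RHS](E t t3) !big_ord_recr big_ord0 /frame /=.
  by case: t t3 => [|[|[|//]]] _; rewrite /= !(mulr0, mulr1, add0r, addr0).
have c3 : c 3%N = 0.
  have [<-//|l03] := eqVneq l0 3%N.
  by rewrite -[RHS](E l0) ?cl0 ?add0r // ltn_neqAle l03.
move=> l l4; have [->//|l3] := eqVneq l 3%N.
by rewrite -[RHS](E l) ?c3 ?addr0 // ltn_neqAle l3.
Qed.

(** A multi-index whose first three entries form an even word w_l is at distance at
    least 2 from the other even words, so these coordinates give the tangent
    directions in the last factor at the point l. Changing one entry of w_l gives
    a word at distance 1 from at most three even words; the vectors of the last
    factor at these are three members of a frame, hence independent. *)
Lemma even_word_injective (n : 'I_4 -> nat) :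
    (forall i, 1 <= n i)%N -> (2 <= n ord_max)%N ->
  tangent_injective 4 n even_word_point even_word ord_max.
Proof.
move=> n1 n2 y yt anch.
(* C p q r l is the coefficient of the l-th frame vector in the fibre over p q r *)
pose C p q r l := y l 0%N p * ((q == even_word l 1) && (r == even_word l 2))%:R
  + y l 1%N q * ((p == even_word l 0) && (r == even_word l 2))%:R
  + y l 2%N r * ((p == even_word l 0) && (q == even_word l 1))%:R.
pose o0 : 'I_4 := @Ordinal 4 0 isT; pose o1 : 'I_4 := @Ordinal 4 1 isT.
pose o2 : 'I_4 := @Ordinal 4 2 isT.
have w1 l i : (even_word l i <= 1)%N.
  by case: l => [|[|[|[|l]]]]; case: i => [|[|[|[|i]]]] //; rewrite /even_word /= nth_nil.
have E p q r t : (p <= n o0)%N -> (q <= n o1)%N -> (r <= n o2)%N -> (t <= n ord_max)%N ->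
    \sum_(l < 4) C p q r l * frame F l t + \sum_(l < 4) y l 3%N t *
      [&& p == even_word l 0, q == even_word l 1 & r == even_word l 2]%:R = 0.
  move=> pn qn rn tn; rewrite -[RHS](yt (nth 0%N [:: p; q; r; t])); last first.
    case=> [[|[|[|[|//]]]] i4] /=; rewrite (bool_irrelevance i4 isT) //.
    by rewrite [Ordinal _](_ : _ = ord_max) //; apply: val_inj.
  rewrite tangent4E -big_split; apply: eq_bigr => l _ /=; rewrite /even_word_point /= /C.
  by rewrite !(=^~ mulnb, natrM); ring.
have anch' l i : (l < 4)%N -> (i < 3)%N -> y l i (even_word l i) = 0.
  move=> l4 i3; have i4 : (i < 4)%N := ltnW i3.
  by apply: (anch (Ordinal l4) (Ordinal i4)); rewrite -val_eqE /= ltn_eqF.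
have y3 l t : (l < 4)%N -> (t <= n ord_max)%N -> y l 3%N t = 0.
  move=> l4 tn.
  have := E (even_word l 0) (even_word l 1) (even_word l 2) t
    (leq_trans (w1 l 0%N) (n1 _)) (leq_trans (w1 l 1%N) (n1 _))
    (leq_trans (w1 l 2%N) (n1 _)) tn.
  rewrite /C !big_ord_recr !big_ord0 /=.
  case: l l4 => [|[|[|[|//]]]] l4; have := anch' _ 0%N l4 isT; have := anch' _ 1%N l4 isT;
    have := anch' _ 2%N l4 isT; rewrite /even_word /= => -> -> ->;
    by rewrite !(mulr0, mul0r, mulr1, add0r, addr0).
have key p q r l0 : (p <= n o0)%N -> (q <= n o1)%N -> (r <= n o2)%N -> (l0 < 4)%N ->
    C p q r l0 = 0 -> forall l, (l < 4)%N -> C p q r l = 0.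
  move=> pn qn rn l04 C0; apply: (frame_free3 l04 C0) => t t3.
  have tn : (t <= n ord_max)%N by apply: leq_trans n2.
  rewrite -[RHS](E p q r t pn qn rn tn) [X in _ = _ + X]big1 ?addr0 // => l _.
  by rewrite y3 ?mul0r.
case=> [l l4] [i i4] b /= bn.
have [->|bw] := eqVneq b (even_word l i).
  case: (ltnP i 3) => i3; first exact: anch'.
  have -> : i = 3%N by apply/eqP; rewrite eqn_leq i3 -ltnS i4.
  by rewrite y3 // (leq_trans (w1 _ _)).
case: i i4 bn bw => [|[|[|[|//]]]] i4; rewrite (bool_irrelevance i4 isT) => bn bw.
- have H l0 := key b (even_word l 1) (even_word l 2) l0 bn
    (leq_trans (w1 _ _) (n1 _)) (leq_trans (w1 _ _) (n1 _)).
  (* the other even word with the same first entry does not meet the fibre *)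
  have := H (nth 0 [:: 1; 0; 3; 2] l)%N _ _ l l4.
  case: l l4 bw {H} => [|[|[|[|//]]]] l4; rewrite /C /even_word /= => /negbTE ->;
  rewrite !(mulr0, addr0, mulr1); exact.
- have H l0 := key (even_word l 0) b (even_word l 2) l0
    (leq_trans (w1 _ _) (n1 _)) bn (leq_trans (w1 _ _) (n1 _)).
  have := H (nth 0 [:: 2; 3; 0; 1] l)%N _ _ l l4.
  case: l l4 bw {H} => [|[|[|[|//]]]] l4; rewrite /C /even_word /= => /negbTE ->;
  rewrite ?andbF !(mulr0, addr0, add0r, mulr1); exact.
- have H l0 := key (even_word l 0) (even_word l 1) b l0
    (leq_trans (w1 _ _) (n1 _)) (leq_trans (w1 _ _) (n1 _)) bn.
  have := H (nth 0 [:: 3; 2; 1; 0] l)%N _ _ l l4.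
  case: l l4 bw {H} => [|[|[|[|//]]]] l4; rewrite /C /even_word /= => /negbTE ->;
  rewrite ?andbF !(mulr0, addr0, add0r, mulr1); exact.
by apply: y3 => //; move: bn; rewrite [Ordinal _](_ : _ = ord_max) //; apply: val_inj.
Qed.

End FourFactors.

(** * Criteria for defectivity and non-defectivity *)

Section Dimension.
Variables (F : fieldType) (N : nat) (Z : ppoint F N -> Prop).

Lemma has_dim_unique d d' : has_dim Z d -> has_dim Z d' -> d = d'.
Proof.
by move=> [cd maxd] [cd' maxd']; apply/eqP; rewrite eqn_leq maxd' // maxd.
Qed.

(** A bounded nonempty set of lengths of chains has a largest element. *)
Lemma has_dim_bounded b c :
    (forall e, has_chain Z e -> (e < b)%N) -> has_chain Z c ->
  exists2 d, (d < b)%N & has_dim Z d.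
Proof.
move=> chain_lt; have [m] := ubnP (b - c)%N; elim: m c => // m IH c bc cc.
have [[e [ce ec]]|maxc] := classic (exists e, (c < e)%N /\ has_chain Z e).
  by have eb := chain_lt e ec; apply: (IH e) => //; lia.
exists c; first exact: chain_lt.
split=> // e ce; rewrite leqNgt; apply/negP => ec.
by apply: maxc; exists e.
Qed.

End Dimension.

Section Criteria.
Variable F : fieldType.
Hypothesis charF0 : [pchar F]%R =i pred0.
Variables (s k : nat) (n : 'I_k -> nat).
Hypothesis s_gt0 : (0 < s)%N.
Hypothesis k_gt0 : (0 < k)%N.
Implicit Types (v : nat -> nat -> nat -> F).

Lemma chain_le_expected e :
  has_chain (secant_variety s (segre F n)) e -> (e <= expected_dim n s)%N.
Proof.
move=> ce; have eN := secant_bound_ambient charF0 k_gt0 ce.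
have es := secant_bound_params charF0 k_gt0 ce.
rewrite card_multi_index in eN; rewrite /expected_dim; move: eN es.
by set P := (\prod_(i < k) _)%N; set S := (\sum_(i < k) _)%N; rewrite mulnS; lia.
Qed.

Lemma nondefective_of_rank v :
    (exists2 j : nat -> nat, forall i : 'I_k, (j i <= n i)%N
       & tensor_sum s k v j != 0) ->
    (expected_dim n s < \rank (secant_jacobian s n v))%N ->
  segre_nondefective F n s.
Proof.
case=> j jn vj rk; have [x xj] := nat_index_surj jn.
have ch : has_chain (secant_variety s (segre F n)) (\rank (secant_jacobian s n v)).-1.
  by apply: secant_chain => //; exists x; rewrite (eq_tensor_sum _ _ xj).
split; last exact: chain_le_expected.
suff -> : expected_dim n s = (\rank (secant_jacobian s n v)).-1 by [].
by have := chain_le_expected ch; lia.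
Qed.

Lemma nondefective_of_injective v (anchor : nat -> nat -> nat) (i0 : 'I_k) :
    (exists2 j : nat -> nat, forall i : 'I_k, (j i <= n i)%N
       & tensor_sum s k v j != 0) ->
    (forall (l : 'I_s) (i : 'I_k), (anchor l i <= n i)%N) ->
    tangent_injective s n v anchor i0 ->
  segre_nondefective F n s.
Proof.
move=> vj anchn vinj; apply: (nondefective_of_rank vj).
apply: leq_trans (secant_jacobian_rank_ge k_gt0 anchn vinj).
rewrite /expected_dim mulnS.
set P := (\prod_(i < k) _)%N; set S := (\sum_(i < k) _)%N; lia.
Qed.

Lemma nondefective_of_surjective v :
    (exists2 j : nat -> nat, forall i : 'I_k, (j i <= n i)%N
       & tensor_sum s k v j != 0) ->
    tangent_surjective s n v ->
  segre_nondefective F n s.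
Proof.
move=> vj vsurj; apply: (nondefective_of_rank vj).
rewrite (secant_jacobian_full vsurj) card_multi_index /expected_dim.
have : (0 < \prod_(i < k) (n i).+1)%N by rewrite prodn_gt0.
by set P := (\prod_(i < k) _)%N; lia.
Qed.

Lemma codeword_tensor_neq0 (w : nat -> nat -> nat) :
    (forall i : 'I_k, (w 0%N i <= n i)%N) ->
  exists2 j : nat -> nat, forall i : 'I_k, (j i <= n i)%N
    & tensor_sum s k (codeword_point F w) j != 0.
Proof.
move=> w0n; exists (w 0%N) => //; rewrite /tensor_sum.
have -> : \sum_(l < s) \prod_(i < k) codeword_point F w l i (w 0%N i) =
    (\sum_(l < s) \prod_(i < k) (w 0%N i == w l i : nat))%:R.
  by rewrite natr_sum; apply: eq_bigr => l _; rewrite natr_prod.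
rewrite ((pcharf0P F).1 charF0) (bigD1 (Ordinal s_gt0)) //= big1 ?add1n // => i _.
by rewrite eqxx.
Qed.

Lemma nondefective_of_separated_code (w : nat -> nat -> nat) :
    (forall (l : 'I_s) (i : 'I_k), (w l i <= n i)%N) ->
    (forall l l' : 'I_s, l != l' ->
       (2 < #|[set i : 'I_k | w l i != w l' i]|)%N) ->
  segre_nondefective F n s.
Proof.
move=> wn wsep.
apply: (nondefective_of_injective (codeword_tensor_neq0 (wn (Ordinal s_gt0))) wn).
exact: (separated_code_injective (i0 := Ordinal k_gt0) wn wsep).
Qed.

Lemma nondefective_of_covering_code (w : nat -> nat -> nat) :
    (forall i : 'I_k, (w 0%N i <= n i)%N) ->
    (forall j : nat -> nat, (forall i : 'I_k, (j i <= n i)%N) ->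
      exists (l : 'I_s) (i0 : 'I_k), forall i : 'I_k, i != i0 -> j i = w l i) ->
  segre_nondefective F n s.
Proof.
move=> wn wcov.
apply: (nondefective_of_surjective (codeword_tensor_neq0 wn)).
exact: covering_code_surjective.
Qed.

(** The dimension is the greatest length of a chain, so a strict bound on lengths
    by the expected dimension is enough. *)
Lemma defective_of_bound b :
    (forall e, has_chain (secant_variety s (segre F n)) e -> (e < b)%N) ->
    (b <= expected_dim n s)%N ->
  segre_defective F n s.
Proof.
move=> chain_lt bE.
have [|j jn vj] := codeword_tensor_neq0 (w := fun _ _ => 0%N); first by [].
have [x xj] := nat_index_surj jn.
have [|d db dimd] := has_dim_bounded chain_lt (c := (\rank
    (secant_jacobian s n (codeword_point F (fun _ _ => 0%N)))).-1).
  by apply: secant_chain => //; exists x; rewrite (eq_tensor_sum _ _ xj).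
by exists d => //; apply: leq_trans bE.
Qed.

End Criteria.

(** * The four-secant varieties *)

Section FourSecant.
Variable F : fieldType.
Hypothesis charF0 : [pchar F]%R =i pred0.

Definition word_table (ws : seq (seq nat)) (l i : nat) : nat := nth 0%N (nth [::] ws l) i.

(** If b = 1, the four coordinate points of F^2 x F^2 already cover. Otherwise the
    sum of the four tangent spaces is direct for (1, >= 3, >= 3) and for
    (>= 2, >= 2, >= 3), and fills the space for (1, 2, 2) and (1, 2, 3). *)
Lemma nondefective3 (n : 'I_3 -> nat) a b c :
    (forall i : 'I_3, n i = nth 0%N [:: a; b; c] i) ->
    (1 <= a <= b)%N -> (b <= c)%N ->
    ~~ [&& a == 1, b == 2 & 4 <= c]%N -> ~~ [&& a == 2, b == 2 & c == 2]%N ->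
  segre_nondefective F n 4.
Proof.
move=> nE /andP[a1 ab] bc exc1 exc2.
have n0 : n (@Ordinal 3 0 isT) = a by rewrite nE.
have n1 : n (@Ordinal 3 1 isT) = b by rewrite nE.
have n2 : n (@Ordinal 3 2 isT) = c by rewrite nE.
have range (j : nat -> nat) : (forall i : 'I_3, (j i <= n i)%N) ->
    [/\ j 0 <= a, j 1 <= b & j 2 <= c]%N.
  by move=> jn; split; [rewrite -n0|rewrite -n1|rewrite -n2]; apply: jn (Ordinal _).
have [b1|b1] := leqP b 1.
  apply: (@nondefective_of_covering_code _ charF0 4 3 n _ _
    (word_table [:: [:: 0; 0; 0]; [:: 0; 1; 0]; [:: 1; 0; 0]; [:: 1; 1; 0]]%N)) => //.
    by move=> [[|[|[|//]]] ?].
  move=> j /range[j0 j1 _].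
  have {a1 ab bc} [j0' j1'] : (j 0 <= 1)%N /\ (j 1 <= 1)%N by lia.
  have l4 : (2 * j 0 + j 1 < 4)%N by lia.
  exists (Ordinal l4), (@Ordinal 3 2 isT).
  case=> [[|[|[|//]]] i3] //= _; rewrite /word_table;
    by move: j0' j1'; case: (j 0)%N (j 1)%N => [|[|?]] [|[|?]].
have [a2|a2] := leqP a 1; last first.
  have c3 : (3 <= c)%N by lia.
  have := @frame_injective F n; rewrite n0 n1 n2 => /(_ a2 b1 c3).
  apply: nondefective_of_injective => //.
    exists (fun=> 0%N) => //; rewrite /tensor_sum !big_ord_recr !big_ord0 /=.
    by rewrite /frame /= !(mulr0, mul0r, mulr1, add0r, addr0) oner_eq0.
  move=> [l l4] [[|[|[|//]]] i3]; rewrite nE /sliced_anchor /=; try lia.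
  case: ifP => l3; lia.
have {a1 a2 ab} a1 : a = 1%N by lia.
have [b2|b2] := leqP b 2; last first.
  have := @pencil_injective F n charF0; rewrite n0 n1 n2 a1 => /(_ isT b2 (leq_trans b2 bc)).
  apply: nondefective_of_injective => //.
    exists (fun=> 0%N) => //; rewrite /tensor_sum !big_ord_recr !big_ord0 /=.
    by rewrite !(mulr0, mul0r, mulr1, add0r, addr0) oner_eq0.
  by move=> [l l4] [[|[|[|//]]] i3]; rewrite nE /sliced_anchor /=; lia.
have {b1 b2} b2 : b = 2%N by lia.
have [c2|c2] := leqP c 2.
  have {c2 bc exc1 exc2} c2 : c = 2%N by lia.
  apply: (@nondefective_of_covering_code _ charF0 4 3 n _ _
    (word_table [:: [:: 0; 0; 0]; [:: 0; 1; 1]; [:: 1; 2; 2]; [:: 1; 0; 0]]%N)) => //.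
    by move=> [[|[|[|//]]] ?].
  move=> j /range[]; rewrite a1 b2 c2 => j0 j1 j2.
  (* the word next to (x, y, z) and the place where they may differ *)
  pose sol (x y z : nat) : nat * nat := match x, y, z with
    | 0, 0, _ => (0, 2) | 0, _, 0 => (0, 1) | 0, 1, _ => (1, 2) | 0, _, 1 => (1, 1)
    | 0, _, _ => (2, 0)
    | _, 2, _ => (2, 2) | _, _, 2 => (2, 1) | _, 0, _ => (3, 2) | _, _, 0 => (3, 1)
    | _, _, _ => (1, 0) end%N.
  have sol1 : ((sol (j 0) (j 1) (j 2)).1 < 4)%N.
    by case: (j 0)%N (j 1)%N (j 2)%N => [|[|?]] [|[|[|?]]] [|[|[|?]]].
  have sol2 : ((sol (j 0) (j 1) (j 2)).2 < 3)%N.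
    by case: (j 0)%N (j 1)%N (j 2)%N => [|[|?]] [|[|[|?]]] [|[|[|?]]].
  exists (Ordinal sol1), (Ordinal sol2) => i; rewrite -val_eqE /= => {sol1 sol2}.
  move: j0 j1 j2; case: i => [[|[|[|//]]] i3] /=;
  by case: (j 0)%N (j 1)%N (j 2)%N => [|[|?]] [|[|[|?]]] [|[|[|?]]].
have {c2 bc exc2} c3 : c = 3%N by move: exc1; rewrite a1 b2 /=; lia.
have := @pencil_surjective F n charF0; rewrite n0 n1 n2 a1 b2 c3 => /(_ erefl erefl erefl).
apply: nondefective_of_surjective => //.
exists (fun=> 0%N) => //; rewrite /tensor_sum !big_ord_recr !big_ord0 /=.
by rewrite !(mulr0, mul0r, mulr1, add0r, addr0) oner_eq0.
Qed.

Lemma nondefective4 (n : 'I_4 -> nat) : (forall i, 1 <= n i)%N ->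
    (forall i, n i <= n ord_max)%N ->
  segre_nondefective F n 4.
Proof.
move=> n1 nmax; have [n2|n2] := leqP 2 (n ord_max).
  have := @even_word_injective F n n1 n2; apply: nondefective_of_injective => //.
    exists (fun=> 0%N) => //; rewrite /tensor_sum !big_ord_recr !big_ord0 /=.
    rewrite /even_word_point /even_word /frame /=.
    by rewrite !(mulr0, mul0r, mulr1, add0r, addr0) oner_eq0.
  move=> l i; apply: leq_trans (n1 i).
  by case: l => [[|[|[|[|//]]]] ?]; case: i => [[|[|[|[|//]]]] ?].
apply: (@nondefective_of_covering_code _ charF0 4 4 n _ _
    (word_table [:: [:: 0; 0; 0; 0]; [:: 0; 0; 0; 1];
                    [:: 1; 1; 1; 0]; [:: 1; 1; 1; 1]]%N)) => //.
  by move=> [[|[|[|[|//]]]] ?].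
move=> j jn; have {}jn i : (i < 4)%N -> (j i <= 1)%N.
  by move=> i4; have := jn (Ordinal i4); have := nmax (Ordinal i4); move=> /=; lia.
have := jn 0%N isT; have := jn 1%N isT; have := jn 2%N isT; have := jn 3%N isT.
(* the word next to (x, y, z, t) and the place where they may differ *)
pose sol (x y z t : nat) : nat * nat := match x, y, z with
    | 0, 0, _ => (t, 2) | 0, _, 0 => (t, 1) | _, 0, 0 => (t, 0)
    | 0, _, _ => (2 + t, 0) | _, 0, _ => (2 + t, 1) | _, _, _ => (2 + t, 2) end%N.
have [sol1 sol2] : ((sol (j 0) (j 1) (j 2) (j 3)).1 < 4)%N /\
    ((sol (j 0) (j 1) (j 2) (j 3)).2 < 4)%N.
  move: (jn 3%N isT).
  by case: (j 0)%N (j 1)%N (j 2)%N (j 3)%N => [|?] [|?] [|?] [|[|?]].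
move=> j3 j2 j1 j0.
exists (Ordinal sol1), (Ordinal sol2) => i; rewrite -val_eqE /= => {sol1 sol2}.
move: j0 j1 j2 j3; case: i => [[|[|[|[|//]]]] i3] /=;
by case: (j 0)%N (j 1)%N (j 2)%N (j 3)%N => [|[|?]] [|[|?]] [|[|?]] [|[|?]].
Qed.

(** The words form a binary linear code of length 5, dimension 2 and minimum
    distance 3. *)
Lemma nondefective5 k (n : 'I_k -> nat) : (5 <= k)%N -> (forall i, 1 <= n i)%N ->
  segre_nondefective F n 4.
Proof.
move=> k5 n1; have k0 : (0 < k)%N by apply: leq_trans k5.
apply: (@nondefective_of_separated_code _ charF0 4 k n isT k0
  (word_table [:: [:: 0; 0; 0; 0; 0]; [:: 1; 1; 1; 0; 0];
                  [:: 0; 0; 1; 1; 1]; [:: 1; 1; 0; 1; 1]]%N)).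
  move=> l i; apply: leq_trans (n1 i); rewrite /word_table.
  case: l => [[|[|[|[|//]]]] ?] /=; case: (i : nat) => [|[|[|[|[|m]]]]] //=; by rewrite nth_nil.
move=> l l' ll'; set w := word_table _.
have -> : #|[set i : 'I_k | w l i != w l' i]| = (\sum_(i < k) (w l i != w l' i))%N.
  by rewrite -sum1_card big_mkcond; apply: eq_bigr => i _; rewrite inE; case: (_ != _).
rewrite -(subnKC k5) big_split_ord /= !big_ord_recr big_ord0 /=.
apply: leq_trans (leq_addr _ _); move: ll'; rewrite -val_eqE /w /word_table.
by case: l => [[|[|[|[|//]]]] ?]; case: l' => [[|[|[|[|//]]]] ?].
Qed.

Lemma defective_unbalanced (n : 'I_3 -> nat) a :
    (forall i : 'I_3, n i = nth 0%N [:: 1; 2; a] i)%N -> (4 <= a)%N ->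
  segre_defective F n 4.
Proof.
move=> nE a4.
have n0 : n (@Ordinal 3 0 isT) = 1%N by rewrite nE.
have n1 : n (@Ordinal 3 1 isT) = 2%N by rewrite nE.
have n2 : n (@Ordinal 3 2 isT) = a by rewrite nE.
apply: (@defective_of_bound _ charF0 4 3 n isT isT (4 * (2 * 3) + 4 * (a.+1 - 4))).
  move=> e ce; have := secant_bound_flattening charF0 _ ce.
  by rewrite n0 n1 n2; apply; lia.
by rewrite /expected_dim !big_ord_recr !big_ord0 /= !nE /=; lia.
Qed.

Lemma defective222 (n : 'I_3 -> nat) : (forall i, n i = 2%N) -> segre_defective F n 4.
Proof.
move=> nE; apply: (@defective_of_bound _ charF0 4 3 n isT isT 26).
  by move=> e; apply: strassen_bound.
by rewrite /expected_dim !big_ord_recr !big_ord0 /= !nE.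
Qed.

End FourSecant.

Local Close Scope ring_scope.

Theorem theorem4p6 (F : fieldType) (charF0 : [pchar F]%R =i pred0)
    (k : nat) (n : k.-tuple nat)
    (k_ge3 : 3 <= k)
    (n_ge1 : forall i : 'I_k, 1 <= tnth n i)
    (n_sorted : forall i j : 'I_k, i <= j -> tnth n i <= tnth n j) :
  let exceptional :=
    (exists2 a : nat, 4 <= a & tval n = [:: 1; 2; a])
    \/ tval n = [:: 2; 2; 2] in
  (segre_nondefective F (tnth n) 4 <-> ~ exceptional)
  /\ (segre_defective F (tnth n) 4 <-> exceptional).
Proof.
move=> exceptional.
have excl : segre_nondefective F (tnth n) 4 -> segre_defective F (tnth n) 4 -> False.
  by move=> nd [d dE /(has_dim_unique nd) E]; rewrite -E ltnn in dE.
have nE (i : 'I_k) : tnth n i = nth 0 n i by apply: tnth_nth.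
have def : exceptional -> segre_defective F (tnth n) 4.
  have size_n := size_tuple n.
  case=> [[a a4 E]|E]; rewrite E /= in size_n nE; clear E n_ge1 n_sorted excl exceptional k_ge3;
    case: _ / size_n n nE => n nE.
    exact: (defective_unbalanced charF0 nE).
  by apply: (defective222 charF0) => i; rewrite nE; case: i => [[|[|[|//]]] ?].
have nondef : ~ exceptional -> segre_nondefective F (tnth n) 4.
  move=> nexc; case: (ltngtP k 4) => k4; last first.
  - subst k; apply: (nondefective4 charF0) => // i.
    by apply: n_sorted; rewrite /= -ltnS.
  - exact: (nondefective5 charF0).
  - have k3 : k = 3 by lia.
    have nexc1 a : 4 <= a -> tval n <> [:: 1; 2; a].
      by move=> a4 E; apply: nexc; left; exists a.
    have nexc2 : tval n <> [:: 2; 2; 2] by move=> E; apply: nexc; right.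
    clear exceptional excl def nexc; subst k.
    case: n n_ge1 n_sorted nE nexc1 nexc2 => -[|a [|b [|c [|//]]]] //= sz.
    move=> n_ge1 n_sorted nE nexc1 nexc2.
    have a1 := n_ge1 (@Ordinal 3 0 isT).
    have ab := n_sorted (@Ordinal 3 0 isT) (@Ordinal 3 1 isT) isT.
    have bc := n_sorted (@Ordinal 3 1 isT) (@Ordinal 3 2 isT) isT.
    rewrite !nE /= in a1 ab bc.
    apply: (nondefective3 charF0 nE) => //; first by rewrite a1.
      by apply/negP => /and3P[/eqP ea /eqP eb /nexc1]; rewrite ea eb.
    by apply/negP => /and3P[/eqP ea /eqP eb /eqP ec]; apply: nexc2; rewrite ea eb ec.
split; split=> //.
  by move=> nd exc; apply: excl nd (def exc).
by move=> d; apply: NNPP => /nondef nd; apply: excl nd d.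
Qed.
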